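(* Let $W\in\mathbb{R}^{d_L\times d_0}$, let $S=S^W_{\underline{r}}$ be the stratum with rank list $\underline{r}$ in the rank stratification of the fiber $\mu^{-1}(W)$, and let $\theta=(W_L,\ldots,W_1)\in S$, with flow prebasis subspaces $a_{kji},b_{kji}$ chosen at $\theta$. Then: (1) the dimension of $S$ is $$D^{\mathrm{strat}}=d_\theta-\operatorname{rk}W\cdot(d_L+d_0-\operatorname{rk}W)-\sum_{L\ge k+1\ge i>0}(\operatorname{rk}W_{k+1\sim i}-\operatorname{rk}W_{k+1\sim i-1})(\operatorname{rk}W_{k\sim i-1}-\operatorname{rk}W_{k+1\sim i-1});$$ (2) $\Theta^{\mathrm{strat}}$ is a prebasis for the tangent space $T_\theta S$ (in particular, $T_\theta S=\operatorname{span}\Theta^{\mathrm{strat}}$); (3) $\Psi^{\mathrm{strat}}$ is a prebasis for the normal space $N_\theta S$ (in particular, $N_\theta S=\operatorname{span}\Psi^{\mathrm{strat}}$).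
   Context: Fix integers $L\ge1$, $d_0,\ldots,d_L\ge1$. Weight space: $\mathbb{R}^{d_\theta}=\mathbb{R}^{d_L\times d_{L-1}}\times\cdots\times\mathbb{R}^{d_1\times d_0}$ with the Euclidean inner product, $d_\theta=\sum_{j=1}^Ld_jd_{j-1}$. For $\theta=(W_L,\ldots,W_1)$ and $L\ge k\ge i\ge0$, $W_{k\sim i}=W_kW_{k-1}\cdots W_{i+1}$, $W_{k\sim k}=I_{d_k\times d_k}$; conventions $W_{j\sim-1}=0_{d_j\times1}$, $W_{L+1\sim j}=0_{1\times d_j}$. $\mu(\theta)=W_{L\sim0}$, $\mu^{-1}(W)=\{\theta:\mu(\theta)=W\}$. The rank list of $\theta$ is $\langle\operatorname{rk}W_{k\sim i}\rangle_{L\ge k\ge i\ge0}$ and $S^W_{\underline r}=\{\theta\in\mu^{-1}(W):\text{the rank list of }\theta\text{ is }\underline r\}$; each stratum is a $C^\infty$ embedded manifold. $T_\theta S$ is the tangent space of $S$ at $\theta$ as a linear subspace of $\mathbb{R}^{d_\theta}$ and $N_\theta S=(T_\theta S)^\perp$. A set of subspaces $\Theta$ is a prebasis for a vector space $V$ if the subspaces are linearly independent (each meets the sum of the others only in $\mathbf 0$) and $\operatorname{span}\Theta:=\sum_{\sigma\in\Theta}\sigma=V$. For subspaces $Y\subseteq Z$, $Z\downarrow Y=\{X\subseteq Z:Z=X\oplus Y\}$. For a matrix $M$ and subspace $Z$, $MZ=\{Mv:v\in Z\}$. Flow subspaces: $A_{kji}=\operatorname{null}W_{k+1\sim j}\cap\operatorname{col}W_{j\sim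 i}$, $B_{kji}=\operatorname{row}W_{k\sim j}\cap\operatorname{null}W_{j\sim i-1}^\top$. For $L\ge k\ge j\ge i\ge0$ choose subspaces of $\mathbb{R}^{d_j}$: $a_{kji}\in A_{kji}\downarrow(A_{k,j,i-1}+A_{k-1,j,i})$ and $b_{kji}\in B_{kji}\downarrow(B_{k,j,i+1}+B_{k+1,j,i})$, chosen to be flow prebasis subspaces: $a_{kji}=W_ja_{k,j-1,i}$ and $b_{k,j-1,i}=W_j^\top b_{kji}$ whenever $L\ge k\ge j>i\ge0$ (such choices exist). Tensor product: $U\otimes V=\{M\in\mathbb{R}^{p\times q}:\operatorname{col}M\subseteq U,\ \operatorname{row}M\subseteq V\}$ for $U\subseteq\mathbb{R}^p$, $V\subseteq\mathbb{R}^q$. One-matrix subspaces: for $L\ge l\ge j\ge i\ge0$, $L\ge k\ge j-1\ge h\ge0$, $\phi_{lkjih}=\{(0,\ldots,0,M,0,\ldots,0):M\in a_{lji}\otimes b_{k,j-1,h}\}$ with $M$ in the position of $W_j$; $\Theta_{\mathrm O}$ is the set of all such $\phi_{lkjih}\ne\{\mathbf 0\}$. Two-matrix subspaces: for $L\ge l>j>h\ge0$ and $L\ge k\ge j\ge i\ge0$, $\tau_{lkjih}=\{(0,\ldots,0,W_{j+1}H,-HW_j,0,\ldots,0):H\in a_{lji}\otimes b_{kjh}\}$, with $W_{j+1}H$ in the position of $W_{j+1}$ and $-HW_j$ in the position of $W_j$; $\Theta_{\mathrm T}$ is the set of all such $\tau_{lkjih}\ne\{\mathbf 0\}$. $\Theta^{\mathrm{strat}}=\{\phi_{lkjih}\in\Theta_{\mathrm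 O}:(L>l\text{ or }h>0)\text{ and }(l\le k\text{ or }i\le h)\}\cup\{\tau_{lkjih}\in\Theta_{\mathrm T}:(l=L\text{ and }h=0)\text{ or }(l>k\text{ and }i>h)\}$. For $L\ge l\ge i\ge0$, $L\ge k\ge h\ge0$, $l>h$: $\psi_{lkih}=\{(X_L,\ldots,X_1):M\in b_{lli}\otimes a_{khh}\}$, where $X_j=W_{l\sim j}^\top MW_{j-1\sim h}^\top$ if $j\in[i,k+1]$ and $X_j=0$ otherwise ($1\le j\le L$). $\Psi^{\mathrm{strat}}=\{\psi_{Lki0}\ne\{\mathbf 0\}:k,i\in[0,L],\ k+1\ge i\}\cup\{\psi_{lkih}\ne\{\mathbf 0\}:L\ge l\ge k+1\ge i>h\ge0\}$. *)

(* Defs.v *)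
From HB Require Import structures.
From mathcomp Require Import all_boot all_order all_algebra.
From mathcomp Require Import all_classical all_reals all_analysis.

Set Implicit Arguments.
Unset Strict Implicit.
Unset Printing Implicit Defensive.

Import Order.TTheory GRing.Theory Num.Theory.
Import numFieldNormedType.Exports.

Local Open Scope classical_set_scope.
Local Open Scope ring_scope.

Section Geometry.
Context {R : realType}.

Fixpoint Cn_on (V W : normedModType R) (n : nat) (U : set V) (f : V -> W) :
    Prop :=
  if n is n'.+1 then
    (forall x, U x -> differentiable f x) /\
    (forall v, Cn_on n' U (fun x => 'D_v f x))
  else forall x, U x -> {for x, continuous f}.

(* Meant for an open U. *)
Definition smooth_on (V W : normedModType R) (U : set V) (f : V -> W) :=
  forall n, Cn_on n U f.

(* S is locally diffeomorphic to R^m, where smoothness of a map defined on a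
   relatively open piece of S means that it extends smoothly to an open set of
   the ambient space: this is a smooth embedded submanifold without boundary. *)
Definition embedded_manifold (m n : nat) (S : set 'rV[R]_n) :=
  forall p, S p ->
    exists (U : set 'rV[R]_n) (V : set 'rV[R]_m)
           (chart : 'rV[R]_n -> 'rV[R]_m) (param : 'rV[R]_m -> 'rV[R]_n),
      [/\ open U, U p & smooth_on U chart] /\
      [/\ open V, smooth_on V param, param @` V = S `&` U &
          forall x, V x -> chart (param x) = x].

(* Velocities at p of the smooth curves that stay in S. *)
Definition tangent_space_at (n : nat) (S : set 'rV[R]_n) (p : 'rV[R]_n) :
    set 'rV[R]_n :=
  [set v | exists (e : R) (g : R -> 'rV[R]_n),
     [/\ 0 < e, smooth_on (ball (0 : R) e) g,
         forall t, ball (0 : R) e t -> S (g t), g 0 = p & derive1 g 0 = v]].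

Definition dotmul (n : nat) (u v : 'rV[R]_n) : R := \sum_i u 0 i * v 0 i.

Definition normal_space_at (n : nat) (S : set 'rV[R]_n) (p : 'rV[R]_n) :
    set 'rV[R]_n :=
  [set v | forall u, tangent_space_at S p u -> dotmul u v = 0].

End Geometry.

Section Prebasis.
Context {K : fieldType} {E : lmodType K}.

(* The (possibly infinite) sum of the members of Theta; {0} if Theta is empty. *)
Definition span_of (Theta : set (set E)) : set E :=
  [set v | exists (n : nat) (sigma : 'I_n -> set E) (x : 'I_n -> E),
     (forall i, Theta (sigma i) /\ sigma i (x i)) /\ v = \sum_i x i].

Definition prebasis (Theta : set (set E)) (V : set E) :=
  [/\ forall sigma, Theta sigma -> GRing.submod_closed [in sigma],
      forall sigma, Theta sigma ->
        sigma `&` span_of (Theta `\ sigma) = [set 0]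
    & span_of Theta = V].

End Prebasis.

Section Subspaces.
Context {K : fieldType}.

Definition colspace m n (M : 'M[K]_(m, n)) : {vspace 'cV[K]_m} :=
  limg (linfun (mulmx M : 'cV[K]_n -> 'cV[K]_m)).
Definition rowspace m n (M : 'M[K]_(m, n)) : {vspace 'cV[K]_n} := colspace M^T.
Definition nullspace m n (M : 'M[K]_(m, n)) : {vspace 'cV[K]_n} :=
  lker (linfun (mulmx M : 'cV[K]_n -> 'cV[K]_m)).
Definition mulmxv m n (M : 'M[K]_(m, n)) (Z : {vspace 'cV[K]_n}) :
    {vspace 'cV[K]_m} :=
  (linfun (mulmx M : 'cV[K]_n -> 'cV[K]_m) @: Z)%VS.

Definition complement_in (vT : vectType K) (Z Y X : {vspace vT}) :=
  (X + Y)%VS = Z /\ (X :&: Y)%VS = 0%VS.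

Definition tensor p q (U : {vspace 'cV[K]_p}) (V : {vspace 'cV[K]_q}) :
    set 'M[K]_(p, q) :=
  [set M | (colspace M <= U)%VS /\ (rowspace M <= V)%VS].

End Subspaces.

Section LinearNetwork.
Context {R : realType} (L : nat) (d : nat -> nat).

Definition dtheta : nat := (\sum_(j < L) d j.+1 * d j)%N.

(* A weight vector is the concatenation of the row-major vectorizations of
   W_1, ..., W_L, so that the Euclidean product is the sum of the entrywise
   products of the layers. *)
Local Notation weights := 'rV[R]_(\sum_(j < L) d j.+1 * d j)%N.

(* layer theta j is W_(j+1); it is 0 for j >= L. *)
Definition layer (theta : weights) (j : nat) : 'M[R]_(d j.+1, d j) :=
  if decP (@idP (j < L)%N) is left h then vec_mx (submxrow theta (Ordinal h))
  else 0.

Definition of_layers (X : forall j : nat, 'M[R]_(d j.+1, d j)) : weights :=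
  \mxrow_(j < L) mxvec (X j).

Lemma of_layersK X j : (j < L)%N -> layer (of_layers X) j = X j.
Proof.
move=> hj; rewrite /layer; case: decP => [h|//].
by rewrite /of_layers mxrowK mxvecK.
Qed.

Lemma layerK theta : of_layers (layer theta) = theta.
Proof.
apply/mxrowP => -[j hj]; rewrite mxrowK /layer; case: decP => [h|//].
by rewrite vec_mxK (bool_irrelevance h hj).
Qed.

(* Zero in every layer but W_(j+1), where it is M. *)
Definition at_layer (j : nat) (M : 'M[R]_(d j.+1, d j)) : weights :=
  of_layers (dfwith (fun i : nat => 0 : 'M[R]_(d i.+1, d i)) j M).

Section AtWeights.
Variable theta : weights.

(* W_(k~i) for k >= i; pid_mx (d k) is the identity when i = k.  As layer theta L
   is 0, subprod L.+1 j is zero for j <= L; it has d L.+1 rows instead of one,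
   which changes neither its rank nor its row space nor its null space. *)
Fixpoint subprod (k i : nat) : 'M[R]_(d k, d i) :=
  match k with
  | 0%N => pid_mx (d 0%N)
  | k'.+1 => if (i <= k')%N then layer theta k' *m subprod k' i
             else pid_mx (d k'.+1)
  end.

Lemma subprod_id k : subprod k k = 1%:M.
Proof. by case: k => [|k] /=; rewrite ?ltnn pid_mx_1. Qed.

Lemma subprod_top j : (j <= L)%N -> subprod L.+1 j = 0.
Proof.
move=> hj; rewrite /= hj /layer; case: decP => [h|_]; last exact: mul0mx.
by have := h; rewrite [X in is_true X]ltnn.
Qed.

(* W_(j~i-1), with W_(j~-1) = 0. *)
Definition subprod_pred (j i : nat) : 'M[R]_(d j, d i.-1) :=
  if i is i'.+1 then subprod j i' else 0.

(* flowA1 k j i is A_(k-1, j, i-1): the shift gives access to A_(k, j, -1) and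
   A_(-1, 0, 0). *)
Definition flowA1 (k j i : nat) : {vspace 'cV[R]_(d j)} :=
  (nullspace (subprod k j) :&: colspace (subprod_pred j i))%VS.
Definition flowA (k j i : nat) : {vspace 'cV[R]_(d j)} := flowA1 k.+1 j i.+1.

Definition flowB (k j i : nat) : {vspace 'cV[R]_(d j)} :=
  (rowspace (subprod k j) :&: nullspace (subprod_pred j i)^T)%VS.

Definition flow_prebasis (a b : forall k j i : nat, {vspace 'cV[R]_(d j)}) :=
  [/\ forall k j i, (i <= j <= k)%N -> (k <= L)%N ->
        complement_in (flowA k j i) (flowA1 k.+1 j i + flowA1 k j i.+1)%VS
          (a k j i),
      forall k j i, (i <= j <= k)%N -> (k <= L)%N ->
        complement_in (flowB k j i) (flowB k j i.+1 + flowB k.+1 j i)%VS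
          (b k j i),
      forall k j i, (i <= j < k)%N -> (k <= L)%N ->
        a k j.+1 i = mulmxv (layer theta j) (a k j i)
    & forall k j i, (i <= j < k)%N -> (k <= L)%N ->
        b k j i = mulmxv (layer theta j)^T (b k j.+1 i)].

Definition Dstrat : int :=
  dtheta%:Z
  - (\rank (subprod L 0%N))%:Z
    * ((d L)%:Z + (d 0%N)%:Z - (\rank (subprod L 0%N))%:Z)
  - \sum_(k < L) \sum_(1 <= i < k.+2)
      ((\rank (subprod k.+1 i))%:Z - (\rank (subprod k.+1 i.-1))%:Z)
      * ((\rank (subprod k i.-1))%:Z - (\rank (subprod k.+1 i.-1))%:Z).

Section Families.
Variables a b : forall k j i : nat, {vspace 'cV[R]_(d j)}.

(* In phi and tau the argument j stands for j - 1 in the usual indexing, so that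
   phi l k j i h lives in W_(j+1), and tau l k j i h in W_(j+2) and W_(j+1). *)
Definition phi (l k j i h : nat) : set weights :=
  [set at_layer M | M in tensor (a l j.+1 i) (b k j h)].

Definition tau (l k j i h : nat) : set weights :=
  [set at_layer (layer theta j.+1 *m H) - at_layer (H *m layer theta j)
     | H in tensor (a l j.+1 i) (b k j.+1 h)].

(* In all the subspaces collected in Psi_strat, the layers in the range satisfy
   h <= j < l, so that only genuine subproducts occur. *)
Definition psi_layers (l k i h : nat) (M : 'M[R]_(d l, d h)) (j : nat) :
    'M[R]_(d j.+1, d j) :=
  if (i <= j.+1 <= k.+1)%N then (subprod l j.+1)^T *m M *m (subprod j h)^T
  else 0.

Definition psi (l k i h : nat) : set weights :=
  [set of_layers (psi_layers k i M) | M in tensor (b l l i) (a k h h)].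

Definition Theta_strat : set (set weights) :=
  [set sigma | sigma <> [set 0] /\
     exists l k j i h,
       [/\ (i <= j.+1 <= l)%N /\ (l <= L)%N,
           (h <= j <= k)%N /\ (k <= L)%N,
           (l < L)%N \/ (0 < h)%N,
           (l <= k)%N \/ (i <= h)%N
         & sigma = phi l k j i h]] `|`
  [set sigma | sigma <> [set 0] /\
     exists l k j i h,
       [/\ (h < j.+1 < l)%N /\ (l <= L)%N,
           (i <= j.+1 <= k)%N /\ (k <= L)%N,
           (l = L /\ h = 0%N) \/ ((k < l)%N /\ (h < i)%N)
         & sigma = tau l k j i h]].

Definition Psi_strat : set (set weights) :=
  [set sigma | sigma <> [set 0] /\
     exists k i, [/\ (k <= L)%N, (i <= L)%N, (i <= k.+1)%N
                   & sigma = psi L k i 0%N]] `|`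
  [set sigma | sigma <> [set 0] /\
     exists l k i h, [/\ (h < i <= k.+1)%N, (k < l <= L)%N, (h <= k)%N
                       & sigma = psi l k i h]].

End Families.
End AtWeights.

Definition stratum (W : 'M[R]_(d L, d 0%N)) (r : nat -> nat -> nat) :
    set weights :=
  [set theta | subprod theta L 0%N = W /\
     forall k i, (i <= k <= L)%N -> \rank (subprod theta k i) = r k i].

End LinearNetwork.

(* Main.v *)
Require Import Defs.
From HB Require Import structures.
From mathcomp Require Import all_boot all_order all_algebra.
From mathcomp Require Import all_classical all_reals all_analysis.
From mathcomp Require Import zify ring.

Set Implicit Arguments.
Unset Strict Implicit.
Unset Printing Implicit Defensive.

Import Order.TTheory GRing.Theory Num.Theory.
Import numFieldNormedType.Exports.

Local Open Scope classical_set_scope.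
Local Open Scope ring_scope.

(** The group of base changes g = (g_0, ..., g_L) with g_L W = W g_0 acts on the
    stratum by (g.p)_j = g_j p_j g_(j-1)^-1, and two points of the stratum, being
    representations of a linear quiver with equal rank lists, are isomorphic;
    hence the stratum is one orbit.  Writing the action as the linear equation
    q_j g_(j-1) = g_j p_j in g gives rational charts around p, and identifies the
    tangent space with the image T of g |-> (p_j g_(j-1) - g_j p_j)_j on the
    linear space of all g with g_L W = W g_0.  Each member of Theta^strat lies in
    T, each member of Psi^strat is orthogonal to T by a telescoping sum of
    traces.  Both families are parts of families which span the weight space and
    whose dimensions add up to at most d_theta, so that both are independent and
    their dimensions add up to d_theta. *)

(** The charts rest on a constancy of rank. For [p], [q] in the stratum, [gauge_diff p q c = 0] is a
    linear equation in [c], and its operator on [fixing W] has the same rank for all such pairs,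
    because isomorphisms carry one pair to another. For [q] near [p] it therefore suffices to solve
    the coordinates of this equation along a basis of T, by inverting a matrix [jac q] that is the
    identity at [q = p]; the remaining equations follow. The resulting maps are rational, and the
    rational functions are closed under directional derivatives, whence smoothness of every order.

    The origin of the count: the multiplicities of the intervals containing [j] add up to [d j], so
    that a layer splits into pieces indexed by two intervals, one for its target and one for its
    source, of dimension the product of the two multiplicities. In an open block the tangent side
    takes all layers but the last, and the normal side takes the last. Hence the two dimensions are
    complementary, the inclusion and the orthogonality become equalities, and D^strat is read off
    the normal side, with one product for each nonempty open block. *)

Section VspacePrebasis.
Variables (K : fieldType) (E : vectType K).

Lemma memv_span_of (I : finType) (P : pred I) (U : I -> {vspace E})
    (Theta : set (set E)) :
  (forall sigma, Theta sigma -> exists2 i, P i & sigma = [set` U i]) ->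
  forall v, span_of Theta v -> v \in (\sum_(i | P i) U i)%VS.
Proof.
move=> sub v [n [sigma [x [sx ->]]]]; apply: rpred_sum => s _.
have [/sub[i Pi ->] /= xi] := sx s.
exact: (subvP (sumv_sup i Pi (subvv _))).
Qed.

(* Members that vanish are dropped and distinct indices of a direct sum give
   distinct nonzero members, so that nothing is lost in passing from the family
   to the set of its members. *)
Lemma prebasis_directv (I : finType) (P : pred I) (U : I -> {vspace E})
    (Theta : set (set E)) (V : set E) :
  (forall sigma, Theta sigma <->
     sigma <> [set 0] /\ exists2 i, P i & sigma = [set` U i]) ->
  directv (\sum_(i | P i) U i) ->
  V = [set` (\sum_(i | P i) U i)%VS] ->
  prebasis Theta V.
Proof.
move=> ThetaE /directv_sumP dU ->; split.
- move=> sigma /ThetaE[_ [i Pi ->]]; split => [|a u v]; rewrite !inE.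
    exact: mem0v.
  by move=> uU vU; apply: memvD => //; apply: memvZ.
- move=> sigma /ThetaE[_ [i Pi ->]]; apply/seteqP; split => v /=; last first.
    move=> ->; split; first exact: mem0v.
    by exists 0%N, (fun=> setT), (fun=> 0); split=> [[]//|]; rewrite big_ord0.
  move=> [vi vs].
  have : v \in (U i :&: \sum_(j | P j && (j != i)) U j)%VS.
    rewrite memv_cap vi /=; apply: (memv_span_of _ vs) => tau [+ ntau].
    move=> /ThetaE[_ [j Pj tauE]]; exists j => //.
    by rewrite Pj /=; apply: contra_not_neq ntau => <-.
  by rewrite dU// memv0 => /eqP.
- apply/seteqP; split => v /=.
    by apply: memv_span_of => sigma /ThetaE[].
  case/memv_sumP => u uU ->.
  pose Q i := P i && (U i != 0%VS).
  have -> : \sum_(i | P i) u i = \sum_(i | Q i) u i.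
    rewrite big_mkcondr; apply: eq_bigr => i Pi; case: eqP => // Ui0.
    by have := uU i Pi; rewrite Ui0 memv0 => /eqP.
  exists #|Q|, (fun s => [set` U (enum_val s)]), (fun s => u (enum_val s)).
  split=> [s|]; last by rewrite big_enum_val.
  have := enum_valP s; rewrite unfold_in => /andP[Ps Us].
  split; last exact: uU.
  apply/ThetaE; split; last by exists (enum_val s).
  apply/eqP; apply: contra Us => /eqP/seteqP[US _].
  by rewrite -subv0; apply/subvP => w wU; rewrite memv0; apply/eqP/US.
Qed.

(** A spanning family has dimensions adding up to at least that of the space. If they are bounded by
    numbers with no larger total, all inequalities in between are equalities. So upper bounds on the
    members, which hold for images of tensor products, yield directness and the exact dimensions
    together. *)
Lemma directv_dim_bound (I : finType) (U : I -> {vspace E}) (m : I -> nat) :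
  (forall i, \dim (U i) <= m i)%N -> (\sum_i U i)%VS = fullv ->
  (\sum_i m i <= \dim {:E})%N ->
  directv (\sum_i U i) /\ forall i, \dim (U i) = m i.
Proof.
move=> Um Uf mE.
have le1 : (\sum_i \dim (U i) <= \sum_i m i)%N by apply: leq_sum => i _.
have le2 : (\dim {:E} <= \sum_i \dim (U i))%N.
  by rewrite -Uf (leq_trans (dimv_leq_sum _ _ _)).
split.
  rewrite directvEgeq/=; apply: leq_trans le1 _.
  by rewrite Uf.
move=> i; apply/eqP; rewrite eqn_leq Um /= leqNgt; apply/negP => lt.
have := leq_trans mE le2; rewrite (bigD1 i)//= [X in (_ <= X)%N](bigD1 i)//=.
rewrite leqNgt -addSn leq_add//.
by apply: leq_sum.
Qed.

Lemma directv_sub (I : finType) (P : pred I) (U : I -> {vspace E}) :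
  directv (\sum_i U i) -> directv (\sum_(i | P i) U i).
Proof.
move=> /directv_sumP dU; apply/directv_sumP => i Pi; apply/eqP.
rewrite -subv0 -[X in (_ <= X)%VS](dU i)//; apply: capvS (subvv _) _.
apply/subv_sumP => j /andP[_ ji].
exact: (sumv_sup j).
Qed.

Lemma dim_directv_sum (I : finType) (P : pred I) (U : I -> {vspace E}) :
  directv (\sum_(i | P i) U i) ->
  \dim (\sum_(i | P i) U i)%VS = (\sum_(i | P i) \dim (U i))%N.
Proof. by move=> /directvP. Qed.

Lemma complement_dim (Z Y X : {vspace E}) :
  complement_in Z Y X -> (\dim X + \dim Y = \dim Z)%N.
Proof. by move=> [<- XY]; rewrite dimv_disjoint_sum. Qed.

End VspacePrebasis.

(** * Column spaces, null spaces and rank *)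

Section MatrixSpaces.
Variable K : fieldType.

Lemma mulmxvP m n (M : 'M[K]_(m, n)) (Z : {vspace 'cV_n}) v :
  reflect (exists2 u, u \in Z & v = M *m u) (v \in mulmxv M Z).
Proof.
by apply: (iffP memv_imgP) => -[u uZ ->]; exists u; rewrite ?lfunE.
Qed.

Lemma memv_mulmxv m n (M : 'M[K]_(m, n)) (Z : {vspace 'cV_n}) u :
  u \in Z -> M *m u \in mulmxv M Z.
Proof. by move=> uZ; apply/mulmxvP; exists u. Qed.

Lemma colspaceE m n (M : 'M[K]_(m, n)) : colspace M = mulmxv M fullv.
Proof. by []. Qed.

Lemma memv_colspace m n (M : 'M[K]_(m, n)) u : M *m u \in colspace M.
Proof. by apply: memv_mulmxv; rewrite memvf. Qed.

Lemma colspaceP m n (M : 'M[K]_(m, n)) v :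
  reflect (exists u, v = M *m u) (v \in colspace M).
Proof.
rewrite colspaceE; apply: (iffP (mulmxvP _ _ _)) => [[u _ ->]|[u ->]];
  by exists u; rewrite ?memvf.
Qed.

Lemma nullspaceE m n (M : 'M[K]_(m, n)) v :
  (v \in nullspace M) = (M *m v == 0).
Proof. by rewrite memv_ker lfunE. Qed.

Lemma mulmxvS m n (M : 'M[K]_(m, n)) (Y Z : {vspace 'cV_n}) :
  (Y <= Z)%VS -> (mulmxv M Y <= mulmxv M Z)%VS.
Proof. exact: limgS. Qed.

Lemma mulmxvM m n p (M : 'M[K]_(m, n)) (N : 'M[K]_(n, p)) Z :
  mulmxv (M *m N) Z = mulmxv M (mulmxv N Z).
Proof.
apply/vspaceP => v; apply/mulmxvP/mulmxvP => [[u uZ ->]|[_ /mulmxvP[u uZ ->] ->]].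
  by exists (N *m u); rewrite ?mulmxA ?memv_mulmxv.
by exists u; rewrite ?mulmxA.
Qed.

Lemma mulmxv1 n (Z : {vspace 'cV[K]_n}) : mulmxv 1%:M Z = Z.
Proof.
apply/vspaceP => v; apply/mulmxvP/idP => [[u uZ ->]|vZ]; rewrite ?mul1mx//.
by exists v; rewrite ?mul1mx.
Qed.

Lemma colspaceM m n p (M : 'M[K]_(m, n)) (N : 'M[K]_(n, p)) :
  colspace (M *m N) = mulmxv M (colspace N).
Proof. by rewrite !colspaceE mulmxvM. Qed.

Lemma colspaceMl m n p (M : 'M[K]_(m, n)) (N : 'M[K]_(n, p)) :
  (colspace (M *m N) <= colspace M)%VS.
Proof. by rewrite colspaceM mulmxvS ?subvf. Qed.

Lemma colspace1 n : colspace (1%:M : 'M[K]_n) = fullv.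
Proof. by rewrite colspaceE mulmxv1. Qed.

Lemma colspace0 m n : colspace (0 : 'M[K]_(m, n)) = 0%VS.
Proof.
apply/eqP; rewrite -subv0; apply/subvP => _ /colspaceP[u ->].
by rewrite mul0mx mem0v.
Qed.

Lemma colspace_sub m n p (M : 'M[K]_(m, n)) (N : 'M[K]_(m, p)) :
  (colspace M <= colspace N)%VS <-> exists X, M = N *m X.
Proof.
split=> [/subvP MN|[X ->]]; last exact: colspaceMl.
have /choice[x xE] j : exists x, col j M = N *m x.
  by apply/colspaceP/MN; rewrite colE memv_colspace.
exists (\matrix_(i, j) x j i 0); apply/matrixP => i j.
have /colP/(_ i) := xE j; rewrite mxE => ->; rewrite !mxE.
by apply: eq_bigr => s _; rewrite !mxE.
Qed.

Lemma dim_cV n : \dim {:'cV[K]_n} = n.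
Proof. by rewrite dimvf; exact: muln1. Qed.

Lemma dim_mulmxv m n (M : 'M[K]_(m, n)) (Z : {vspace 'cV_n}) :
  (\dim (Z :&: nullspace M) + \dim (mulmxv M Z) = \dim Z)%N.
Proof. exact: limg_ker_dim. Qed.

(** One inequality comes from the rank factorization of [M]. Applied to a matrix spanning the
    kernel, the same inequality bounds the nullity from above, and rank-nullity gives the
    converse. *)
Lemma dim_colspace m n (M : 'M[K]_(m, n)) : \dim (colspace M) = \rank M.
Proof.
have le_rank p q (N : 'M[K]_(p, q)) : (\dim (colspace N) <= \rank N)%N.
  rewrite -{1}(mulmx_base N).
  rewrite (leq_trans (dimvS (colspaceMl _ _)))//.
  rewrite -{2}(dim_cV (\rank N)) -(dim_mulmxv (col_base N) fullv).
  exact: leq_addl.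
apply/eqP; rewrite eqn_leq le_rank /=.
have /dimvS : (nullspace M <= colspace (kermx M^T)^T)%VS.
  apply/subvP => v; rewrite nullspaceE => /eqP Mv0; apply/colspaceP.
  have /submxP[D vE] : (v^T <= kermx M^T)%MS.
    by apply/sub_kermxP; rewrite -trmx_mul Mv0 trmx0.
  by exists D^T; rewrite -trmx_mul -vE trmxK.
move=> /leq_trans/(_ (le_rank _ _ _)); rewrite mxrank_tr mxrank_ker mxrank_tr.
have := dim_mulmxv M fullv; rewrite capfv -colspaceE dim_cV.
have := rank_leq_col M.
move: (\dim (nullspace M)) (\dim (colspace M)) (\rank M : nat) => x y r; lia.
Qed.

(** Rank-nullity for [M] restricted to [colspace N]. It turns the dimensions of flow subspaces into
    differences of ranks. *)
Lemma dim_null_col m n p (M : 'M[K]_(m, n)) (N : 'M[K]_(n, p)) :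
  (\dim (nullspace M :&: colspace N) + \rank (M *m N) = \rank N)%N.
Proof. by rewrite -!dim_colspace colspaceM capvC dim_mulmxv. Qed.

End MatrixSpaces.

(** Expresses the Euclidean product of weights by traces, where cyclicity is available for the
    orthogonality computation. *)
Lemma mxvec_tr (K : fieldType) m n (A B : 'M[K]_(m, n)) :
  (mxvec A *m (mxvec B)^T) 0 0 = \tr (A^T *m B).
Proof.
transitivity (\sum_i \sum_j A i j * B i j).
  rewrite mxE (reindex _ (curry_mxvec_bij _ _)) pair_bigA /=.
  by apply: eq_bigr => -[i j] _ /=; rewrite mxE !mxvecE.
rewrite exchange_big; apply: eq_bigr => j _; rewrite mxE.
by apply: eq_bigr => i _; rewrite mxE.
Qed.

(** * Vectors as sequences of matrix blocks *)

Section Pack.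
Variables (R : realType) (n : nat) (e f : nat -> nat).
Local Notation packed := 'rV[R]_(\sum_(j < n) e j * f j)%N.
Local Notation blocks := (forall j : nat, 'M[R]_(e j, f j)).
Implicit Types (u v : packed) (X Y : blocks).

(** Generalizes [layer] to arbitrary block sizes, so as to serve the weights, with blocks [d j.+1]
    by [d j], as well as the base changes, with [L.+1] square blocks. *)
Definition unpack j v : 'M[R]_(e j, f j) :=
  if decP (@idP (j < n)%N) is left h then vec_mx (submxrow v (Ordinal h))
  else 0.

Definition pack X : packed := \mxrow_(j < n) mxvec (X j).

Lemma packK X j : (j < n)%N -> unpack j (pack X) = X j.
Proof. by move=> hj; rewrite /unpack; case: decP => // h; rewrite mxrowK mxvecK. Qed.

Lemma unpackK v : pack (unpack^~ v) = v.
Proof.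
apply/mxrowP => -[j hj]; rewrite mxrowK /unpack; case: decP => // h.
by rewrite vec_mxK (bool_irrelevance h hj).
Qed.

Lemma unpack_out j v : (n <= j)%N -> unpack j v = 0.
Proof. by rewrite /unpack; case: decP => // h; rewrite leqNgt h. Qed.

Lemma eq_pack X Y : (forall j, (j < n)%N -> X j = Y j) -> pack X = pack Y.
Proof. by move=> XY; apply/mxrowP => j; rewrite !mxrowK XY. Qed.

Lemma unpack_inj u v :
  (forall j, (j < n)%N -> unpack j u = unpack j v) -> u = v.
Proof. by move=> uv; rewrite -(unpackK u) -(unpackK v); apply: eq_pack. Qed.

Fact unpack_is_linear j : linear (unpack j).
Proof.
move=> a u v; rewrite /unpack; case: decP => h; last by rewrite scaler0 addr0.
by apply/matrixP => s t; rewrite !mxE.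
Qed.
HB.instance Definition _ j :=
  GRing.isLinear.Build R packed 'M[R]_(e j, f j) *:%R (unpack j)
    (unpack_is_linear j).

Lemma dotmul_unpack u v :
  dotmul u v = \sum_(j < n) \tr ((unpack j u)^T *m unpack j v).
Proof.
have -> : dotmul u v = (u *m v^T) 0 0.
  by rewrite mxE; apply: eq_bigr => i _; rewrite mxE.
rewrite -[X in X *m _]unpackK -[X in _ *m X^T]unpackK /pack tr_mxrow.
rewrite mul_mxrow_mxcol summxE; apply: eq_bigr => j _.
by rewrite mxvec_tr.
Qed.

Lemma pack_entry (s : 'I_(\sum_(j < n) e j * f j)) :
  exists (j : 'I_n) i i', forall X, pack X 0 s = X j i i'.
Proof.
have [i [i' E]] : exists i i', tagnat.sig2 s = mxvec_index i i'.
  by case: (mxvec_indexP (tagnat.sig2 s)) => i i'; exists i, i'.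
by exists (tagnat.sig1 s), i, i' => X; rewrite mxE E mxvecE.
Qed.

Lemma unpack_entry j (i : 'I_(e j)) (i' : 'I_(f j)) : (j < n)%N ->
  exists s, forall v, unpack j v i i' = v 0 s.
Proof.
move=> hj; exists (tagnat.Rank (Ordinal hj) (mxvec_index i i')) => v.
rewrite /unpack; case: decP => // h; rewrite !mxE.
by rewrite (bool_irrelevance h hj).
Qed.

End Pack.

(** * Flow subspaces and the multiplicities of intervals *)

Section Flows.
Variables (R : realType) (L : nat) (d : nat -> nat).
Variable theta : 'rV[R]_(\sum_(j < L) d j.+1 * d j)%N.
Local Notation sp := (subprod theta).
Local Notation spp := (subprod_pred theta).
Local Notation lay := (layer theta).

Lemma subprodS k i : (i <= k)%N -> sp k.+1 i = lay k *m sp k i.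
Proof. by move=> /= ->. Qed.

Lemma subprodM k j i : (i <= j <= k)%N -> sp k i = sp k j *m sp j i.
Proof.
case/andP=> ij; elim: k => [|k IH]; rewrite leq_eqVlt => /orP[/eqP jk|jk] //.
- by subst j; rewrite subprod_id mul1mx.
- by subst j; rewrite subprod_id mul1mx.
- by rewrite !subprodS ?(leq_trans ij)// -mulmxA -IH.
Qed.

Lemma subprod1 j : sp j.+1 j = lay j.
Proof. by rewrite subprodS// subprod_id mulmx1. Qed.

Lemma subprodSr k j : (j < k)%N -> sp k j = sp k j.+1 *m lay j.
Proof. by move=> jk; rewrite (@subprodM k j.+1) ?subprod1 ?leqnSn. Qed.

Lemma subprod_predM k j i : (i <= j.+1)%N -> (j <= k)%N ->
  spp k i = sp k j *m spp j i.
Proof. case: i => [|i] ij jk; first by rewrite /subprod_pred mulmx0.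
by rewrite /subprod_pred (@subprodM k j) // -ltnS ij. Qed.

Lemma subprod_pred_sub j i : (i <= j)%N -> exists X, spp j i = sp j i *m X.
Proof.
case: i => [|i] ij; first by exists 0; rewrite mulmx0.
by exists (lay i); rewrite -subprodSr.
Qed.

Definition rk k i : nat := \rank (sp k i).
Definition rk_pred k i : nat := if i is i'.+1 then rk k i' else 0%N.

Lemma rk_predE k i : \rank (spp k i) = rk_pred k i.
Proof. by case: i => [|i] //; rewrite /subprod_pred mxrank0. Qed.

Lemma rk_top i : (i <= L)%N -> rk L.+1 i = 0%N.
Proof. by move=> iL; rewrite /rk subprod_top ?mxrank0. Qed.

Lemma rk_pred_top i : (i <= L.+1)%N -> rk_pred L.+1 i = 0%N.
Proof. by case: i => // i; exact: rk_top. Qed.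

Lemma rk_diag j : rk j j = d j.
Proof. by rewrite /rk subprod_id mxrank1. Qed.

Lemma dim_flowA1 k j i : (i <= j.+1)%N -> (j <= k)%N ->
  (\dim (flowA1 theta k j i) + rk_pred k i = rk_pred j i)%N.
Proof. by move=> ij jk; rewrite -!rk_predE (subprod_predM ij jk) dim_null_col. Qed.

Lemma dim_flowB k j i : (i <= j.+1)%N -> (j <= k)%N ->
  (\dim (flowB theta k j i) + rk_pred k i = rk k j)%N.
Proof.
move=> ij jk; rewrite /rk -rk_predE (subprod_predM ij jk) -[X in (_ + X)%N]mxrank_tr trmx_mul.
by rewrite /flowB capvC dim_null_col mxrank_tr.
Qed.

Lemma nullspaceS k j : (j <= k)%N ->
  (nullspace (sp k j) <= nullspace (sp k.+1 j))%VS.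
Proof.
move=> jk; apply/subvP => v; rewrite !nullspaceE subprodS// -mulmxA.
by move/eqP->; rewrite mulmx0.
Qed.

(** Null spaces grow with [k] and column spaces with [i], so that the smaller one of each pair
    survives in the intersection. This makes inclusion-exclusion on the sum of the two subspaces
    computable from ranks. *)
Lemma flowA1_cap k j i : (i <= j <= k)%N ->
  (flowA1 theta k.+1 j i :&: flowA1 theta k j i.+1)%VS = flowA1 theta k j i.
Proof.
case/andP=> ij jk; have [X spX] := subprod_pred_sub ij.
have cE : (colspace (spp j i) <= colspace (sp j i))%VS by rewrite spX colspaceMl.
apply/vspaceP => v; move: (subvP (nullspaceS jk) v) (subvP cE v).
rewrite /flowA1 !memv_cap /=; do 4![case: (v \in _)] => //= h1 h2;
  by [have := h1 isT | have := h2 isT].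
Qed.

Lemma flowB_cap k j i : (i <= j <= k)%N ->
  (flowB theta k j i.+1 :&: flowB theta k.+1 j i)%VS = flowB theta k.+1 j i.+1.
Proof.
case/andP=> ij jk.
have rE : (rowspace (sp k.+1 j) <= rowspace (sp k j))%VS.
  by rewrite /rowspace subprodS// trmx_mul colspaceMl.
have [X spX] := subprod_pred_sub ij.
have nE : (nullspace (sp j i)^T <= nullspace (spp j i)^T)%VS.
  apply/subvP => v; rewrite !nullspaceE spX trmx_mul -mulmxA.
  by move/eqP->; rewrite mulmx0.
apply/vspaceP => v; move: (subvP rE v) (subvP nE v).
rewrite /flowB !memv_cap /=; do 4![case: (v \in _)] => //= h1 h2;
  by [have := h1 isT | have := h2 isT].
Qed.

(* The number of copies of the interval [i, k] in the decomposition of theta,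
   seen as a representation of a linearly oriented quiver, into intervals. *)
Definition mult k i : nat :=
  (rk k i + rk_pred k.+1 i - (rk k.+1 i + rk_pred k i))%N.

(** Inclusion-exclusion on the four flow subspaces. The ranks of products ending at layer [j]
    cancel, so the dimension is the same in every layer of the interval. The additive form avoids
    truncated subtraction. *)
Lemma dim_complement_flowA k j i (X : {vspace 'cV[R]_(d j)}) :
  (i <= j <= k)%N ->
  complement_in (flowA theta k j i)
    (flowA1 theta k.+1 j i + flowA1 theta k j i.+1)%VS X ->
  (\dim X + (rk k.+1 i + rk_pred k i) = rk k i + rk_pred k.+1 i)%N.
Proof.
move=> ijk /complement_dim; have /andP[ij jk] := ijk.
have := dimv_sum_cap (flowA1 theta k.+1 j i) (flowA1 theta k j i.+1).
rewrite flowA1_cap// /flowA.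
have := @dim_flowA1 k j i (leqW ij) jk.
have := @dim_flowA1 k.+1 j i (leqW ij) (leqW jk).
have := @dim_flowA1 k j i.+1 ij jk.
have := @dim_flowA1 k.+1 j i.+1 ij (leqW jk).
rewrite /rk_pred -!/(rk_pred _ _).
move: (\dim _) (\dim _) (\dim _) (\dim _) (\dim _) (\dim _) => x1 x2 x3 x4 x5 x6.
lia.
Qed.

Lemma flowA1_sub k j i : (i <= j <= k)%N ->
  (flowA1 theta k.+1 j i + flowA1 theta k j i.+1 <= flowA theta k j i)%VS.
Proof.
case/andP=> ij jk; rewrite subv_add !capvS ?subvv ?nullspaceS// ?andbT.
by have [X ->] := subprod_pred_sub ij; rewrite colspaceMl.
Qed.

(** Takes the place of a_(k,i,i) at any weight vector, where no flow prebasis is given, as for the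
    other points of the stratum. *)
Definition flow_gen k i : {vspace 'cV[R]_(d i)} :=
  (flowA theta k i i :\: (flowA1 theta k.+1 i i + flowA1 theta k i i.+1))%VS.

Lemma flow_genP k i : (i <= k)%N ->
  complement_in (flowA theta k i i)
    (flowA1 theta k.+1 i i + flowA1 theta k i i.+1)%VS (flow_gen k i).
Proof.
move=> ik; split; last exact: capv_diff.
by rewrite addv_diff; apply/addv_idPl/flowA1_sub; rewrite leqnn.
Qed.

(** The subtraction in [mult] is not truncated: the difference is the dimension of the complement
    [flow_gen k i]. *)
Lemma mult_rk k i : (i <= k)%N ->
  (mult k i + (rk k.+1 i + rk_pred k i) = rk k i + rk_pred k.+1 i)%N.
Proof.
move=> ik; rewrite -(dim_complement_flowA _ (flow_genP ik)) ?leqnn//.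
by rewrite /mult -(dim_complement_flowA _ (flow_genP ik)) ?leqnn// addnK.
Qed.

Lemma dim_flow_a k j i (X : {vspace 'cV[R]_(d j)}) : (i <= j <= k)%N ->
  complement_in (flowA theta k j i)
    (flowA1 theta k.+1 j i + flowA1 theta k j i.+1)%VS X ->
  \dim X = mult k i.
Proof. by move=> ijk /(dim_complement_flowA ijk); rewrite /mult => <-; rewrite addnK. Qed.

(** The same inclusion-exclusion on the row side ends in the same alternating sum of ranks, so that
    [a] and [b] share their multiplicities. *)
Lemma dim_flow_b k j i (X : {vspace 'cV[R]_(d j)}) : (i <= j <= k)%N ->
  complement_in (flowB theta k j i)
    (flowB theta k j i.+1 + flowB theta k.+1 j i)%VS X ->
  \dim X = mult k i.
Proof.
move=> ijk /complement_dim; have /andP[ij jk] := ijk.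
have := @mult_rk k i (leq_trans ij jk).
have := dimv_sum_cap (flowB theta k j i.+1) (flowB theta k.+1 j i).
rewrite flowB_cap//.
have := @dim_flowB k j i (leqW ij) jk.
have := @dim_flowB k.+1 j i (leqW ij) (leqW jk).
have := @dim_flowB k j i.+1 ij jk.
have := @dim_flowB k.+1 j i.+1 ij (leqW jk).
rewrite /rk_pred -!/(rk_pred _ _).
move: (\dim _) (\dim _) (\dim _) (\dim _) (\dim _) (\dim _) => x1 x2 x3 x4 x5 x6.
lia.
Qed.

(** Induction on [k + i]: each flow subspace is covered by one [X] and two flow subspaces with
    smaller index sum. The descent ends at [k = j], the kernel of the identity, or at [i = 0], the
    column space of 0. It starts at [flowA1 L.+1 j j.+1], which is the whole space because
    [subprod L.+1 j] vanishes. *)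
Lemma flow_spanA j (X : nat -> nat -> {vspace 'cV[R]_(d j)}) : (j <= L)%N ->
  (forall k i, (i <= j <= k)%N -> (k <= L)%N ->
    flowA theta k j i <=
      X k i + (flowA1 theta k.+1 j i + flowA1 theta k j i.+1))%VS ->
  (\sum_(p : 'I_L.+1 * 'I_L.+1 | (p.2 <= j <= p.1)%N) X p.1 p.2)%VS = fullv.
Proof.
move=> jL spanX; set S := (\sum_(p | _) _)%VS.
have main n k i : (k + i <= n)%N -> (j <= k <= L.+1)%N -> (i <= j.+1)%N ->
    (flowA1 theta k j i <= S)%VS.
  elim: n k i => [|n IH] k i kin /andP[jk kL] ij.
    have [-> ->] : k = 0%N /\ i = 0%N by lia.
    by rewrite /flowA1 colspace0 capv0 sub0v.
  case: i kin ij => [|i] kin ij; first by rewrite /flowA1 colspace0 capv0 sub0v.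
  move: jk; rewrite leq_eqVlt => /orP[/eqP jk|].
    subst k; rewrite /flowA1 subprod_id; apply/subvP => v.
    by rewrite memv_cap nullspaceE mul1mx => /andP[/eqP-> _]; rewrite mem0v.
  case: k kin kL => // k kin kL jk; rewrite ltnS in jk.
  have ijk : (i <= j <= k)%N by rewrite jk andbT -ltnS.
  apply: subv_trans (spanX k i ijk kL) _; rewrite !subv_add; apply/and3P; split.
  - have iL : (i < L.+1)%N by lia.
    exact: (sumv_sup (Ordinal (kL : (k < L.+1)%N), Ordinal iL)).
  - by apply: IH; lia.
  - by apply: IH; lia.
apply/eqP; rewrite eqEsubv subvf /=.
apply: subv_trans (main _ L.+1 j.+1 (leqnn _) _ (leqnn _)); last by lia.
apply/subvP => v _; rewrite /flowA1 /subprod_pred memv_cap nullspaceE.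
by rewrite subprod_top// subprod_id colspace1 memvf mul0mx eqxx.
Qed.

(** The induction runs upwards in [k + i], from the whole space [flowB j j 0] to the zero spaces at
    [k = L.+1] and at [i = j.+1]. *)
Lemma flow_spanB j (X : nat -> nat -> {vspace 'cV[R]_(d j)}) : (j <= L)%N ->
  (forall k i, (i <= j <= k)%N -> (k <= L)%N ->
    flowB theta k j i <=
      X k i + (flowB theta k j i.+1 + flowB theta k.+1 j i))%VS ->
  (\sum_(p : 'I_L.+1 * 'I_L.+1 | (p.2 <= j <= p.1)%N) X p.1 p.2)%VS = fullv.
Proof.
move=> jL spanX; set S := (\sum_(p | _) _)%VS.
have main n k i : (L.+1 + j.+1 - (k + i) <= n)%N -> (j <= k <= L.+1)%N ->
    (i <= j.+1)%N -> (flowB theta k j i <= S)%VS.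
  elim: n k i => [|n IH] k i kin /andP[jk kL] ij.
    have [-> ->] : k = L.+1 /\ i = j.+1 by lia.
    by rewrite /flowB subprod_top// /rowspace trmx0 colspace0 cap0v sub0v.
  move: kL; rewrite leq_eqVlt => /orP[/eqP->|kL].
    by rewrite /flowB subprod_top// /rowspace trmx0 colspace0 cap0v sub0v.
  move: ij; rewrite leq_eqVlt => /orP[/eqP->|ij].
    rewrite /flowB /subprod_pred subprod_id; apply/subvP => v.
    by rewrite memv_cap nullspaceE trmx1 mul1mx => /andP[_ /eqP->]; rewrite mem0v.
  have ijk : (i <= j <= k)%N by rewrite jk andbT -ltnS.
  apply: subv_trans (spanX k i ijk kL) _; rewrite !subv_add; apply/and3P; split.
  - have iL : (i < L.+1)%N by lia.
    exact: (sumv_sup (Ordinal (kL : (k < L.+1)%N), Ordinal iL)).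
  - by apply: IH; lia.
  - by apply: IH; lia.
apply/eqP; rewrite eqEsubv subvf /=.
apply: subv_trans (main _ j 0%N (leqnn _) _ _) => //; last by lia.
apply/subvP => v _; rewrite /flowB /subprod_pred memv_cap nullspaceE.
by rewrite subprod_id /rowspace trmx1 colspace1 memvf trmx0 mul0mx eqxx.
Qed.

Lemma mulmxv_flowA1 k j i i' : (i <= j <= k)%N -> (i' <= i.+1)%N ->
  (mulmxv (sp j i) (flowA1 theta k i i') <= flowA1 theta k j i')%VS.
Proof.
move=> ijk i'i; have /andP[ij jk] := ijk.
apply/subvP => _ /mulmxvP[u + ->]; rewrite /flowA1 !memv_cap !nullspaceE.
case/andP=> /eqP u0 /colspaceP[x xE]; rewrite mulmxA -subprodM// u0 eqxx /=.
by rewrite xE mulmxA -subprod_predM// memv_colspace.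
Qed.

(** The image of [flowA k i i] under W_(j~i) is [flowA k j i], and the smaller flow subspaces are
    mapped into their counterparts in layer [j]; hence the transported generators satisfy the
    covering condition of [flow_spanA]. *)
Lemma flow_gen_span j : (j <= L)%N ->
  (\sum_(p : 'I_L.+1 * 'I_L.+1 | (p.2 <= j <= p.1)%N)
     mulmxv (sp j p.2) (flow_gen p.1 p.2))%VS = fullv.
Proof.
move=> jL; apply: (@flow_spanA j (fun k i => mulmxv (sp j i) (flow_gen k i))) => //.
move=> k i ijk kL; have /andP[ij jk] := ijk.
have -> : flowA theta k j i = mulmxv (sp j i) (flowA theta k i i).
  apply/eqP; rewrite eqEsubv; apply/andP; split; last first.
    by apply: mulmxv_flowA1; lia.
  apply/subvP => v; rewrite memv_cap nullspaceE => /andP[+ /colspaceP[u uE]].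
  rewrite uE mulmxA -subprodM ?ij ?leqW// => u0.
  by rewrite memv_mulmxv// memv_cap nullspaceE u0 /= subprod_id colspace1 memvf.
have [<- _] := flow_genP (leq_trans ij jk).
rewrite /mulmxv limgD addvS ?subvv// limgD.
by rewrite addvS//; apply: mulmxv_flowA1; lia.
Qed.

Local Notation multz k i := ((mult k i)%:Z).
Local Notation rkz k i := ((rk k i)%:Z).
Local Notation rkpz k i := ((rk_pred k i)%:Z).

Lemma mult_rkz k i : (i <= k)%N ->
  multz k i = (rkz k i - rkpz k i) - (rkz k.+1 i - rkpz k.+1 i).
Proof. by move=> /mult_rk; lia. Qed.

(** Counts the intervals that start at [i] and reach [k]. The sum telescopes, and its upper end
    vanishes with the ranks at [L.+1]. *)
Lemma sum_mult_ge k i : (i <= k)%N -> (k <= L)%N ->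
  \sum_(l < L.+1 | (k <= l)%N) multz l i = rkz k i - rkpz k i.
Proof.
move=> ik kL; rewrite -(big_mkord (leq k) (fun l => multz l i)).
rewrite (big_cat_nat _ (n := k))//= ?leqW// big_nat_cond big1 ?add0r; last first.
  by move=> l; lia.
rewrite big_nat_cond (eq_bigl (fun l => (k <= l < L.+1)%N)); last by move=> l; lia.
rewrite -big_nat.
rewrite (telescope_sumr_eq (fun l => - (rkz l i - rkpz l i))) ?leqW//.
  by rewrite rk_top ?rk_pred_top; lia.
by move=> l /andP[kl _]; rewrite mult_rkz; lia.
Qed.

(** Counts the intervals that end at [k] and start no later than [i], by telescoping in the starting
    point. *)
Lemma sum_mult_le k i : (i <= k)%N -> (k <= L)%N ->
  \sum_(h < L.+1 | (h <= i)%N) multz k h = rkz k i - rkz k.+1 i.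
Proof.
move=> ik kL; rewrite -(big_mkord (leq^~ i) (fun h => multz k h)).
rewrite (big_cat_nat _ (n := i.+1))//= ?ltnS ?(leq_trans ik)//.
rewrite addrC big_nat_cond big1 ?add0r; last by move=> l; lia.
rewrite big_nat_cond (eq_bigl (fun l => (0 <= l < i.+1)%N)); last by move=> l; lia.
rewrite -big_nat.
rewrite (telescope_sumr_eq (fun h => rkpz k h - rkpz k.+1 h))//.
  by rewrite /rk_pred; lia.
by move=> h /andP[_ hi]; rewrite mult_rkz /=; lia.
Qed.

(** The sum over the starting points is a difference of consecutive ranks; the sum over the
    endpoints then telescopes to the rank of the identity W_(j~j). *)
Lemma sum_mult j : (j <= L)%N ->
  (\sum_(p : 'I_L.+1 * 'I_L.+1 | (p.2 <= j <= p.1)%N) mult p.1 p.2 = d j)%N.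
Proof.
move=> jL; apply: (@mulrIn int 1); rewrite ?oner_eq0// -[in RHS]rk_diag.
rewrite natr_sum (eq_bigl (fun p : 'I_L.+1 * 'I_L.+1 => (j <= p.1)%N && (p.2 <= j)%N));
  last by move=> p; rewrite andbC.
rewrite -(pair_big (fun k : 'I_L.+1 => (j <= k)%N) (fun i : 'I_L.+1 => (i <= j)%N)
  (fun k i : 'I_L.+1 => (mult k i)%:R)) /=.
rewrite (eq_bigr (fun k : 'I_L.+1 => rkz k j - rkz k.+1 j)); last first.
  by move=> k jk; rewrite -sum_mult_le ?leq_ord//; apply: eq_bigr => i _; rewrite natz.
rewrite -(big_mkord (leq j) (fun k => rkz k j - rkz k.+1 j)).
rewrite (big_cat_nat _ (n := j))//= ?leqW// big_nat_cond big1 ?add0r; last first.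
  by move=> l; lia.
rewrite big_nat_cond (eq_bigl (fun l => (j <= l < L.+1)%N)); last by move=> l; lia.
rewrite -big_nat (telescope_sumr_eq (fun k => - rkz k j)) ?leqW//.
  by rewrite rk_top// natz; lia.
by move=> k _; lia.
Qed.

End Flows.

(** * Tensor products of subspaces *)

Section Tensor.
Variable K : fieldType.

Definition basis_mx n (U : {vspace 'cV[K]_n}) : 'M[K]_(n, \dim U) :=
  \matrix_(i, c) (vbasis U)`_c i 0.

Lemma basis_mxE n (U : {vspace 'cV[K]_n}) x :
  basis_mx U *m x = \sum_c x c 0 *: (vbasis U)`_c.
Proof.
apply/colP => i; rewrite mxE summxE; apply: eq_bigr => c _.
by rewrite !mxE mulrC.
Qed.

Lemma colspace_basis_mx n (U : {vspace 'cV[K]_n}) : colspace (basis_mx U) = U.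
Proof.
apply/vspaceP => v; apply/colspaceP/idP => [[x ->]|vU].
  rewrite basis_mxE; apply: rpred_sum => c _.
  by rewrite memvZ// vbasis_mem// mem_nth// size_tuple.
exists (\col_c coord (vbasis U) c v).
rewrite basis_mxE {1}(coord_vbasis vU); apply: eq_bigr => c _; by rewrite mxE.
Qed.

Lemma pinvmx_basis_mx n (U : {vspace 'cV[K]_n}) :
  pinvmx (basis_mx U) *m basis_mx U = 1%:M.
Proof.
apply: mulVpmx; rewrite /row_full -dim_colspace.
by rewrite colspace_basis_mx.
Qed.

Variables p q : nat.
Implicit Types (U : {vspace 'cV[K]_p}) (V : {vspace 'cV[K]_q}).

(** Writing [M = basis_mx U *m Y] and [M^T = basis_mx V *m Z], the left inverse of [basis_mx U]
    recovers [Y] from [M]; replacing [M] by its other factorization then gives the two-sided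
    form. *)
Lemma tensorP U V M :
  tensor U V M <-> exists X, M = basis_mx U *m X *m (basis_mx V)^T.
Proof.
split=> [[]|[X ->]]; last first.
  split; first by rewrite -mulmxA -[X in (_ <= X)%VS]colspace_basis_mx colspaceMl.
  rewrite /rowspace trmx_mul trmxK.
  by rewrite -[X in (_ <= X)%VS]colspace_basis_mx colspaceMl.
rewrite -{1}(colspace_basis_mx U) -{1}(colspace_basis_mx V).
move=> /colspace_sub[Y MY] /colspace_sub[Z MZ].
exists (pinvmx (basis_mx U) *m Z^T).
rewrite -(mulmxA (basis_mx U)) -(mulmxA (pinvmx _)) -trmx_mul -MZ trmxK MY.
by rewrite (mulmxA (pinvmx _)) pinvmx_basis_mx mul1mx.
Qed.

Definition tensv U V : {vspace 'M[K]_(p, q)} :=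
  limg (linfun (mulmxr (basis_mx V)^T \o mulmx (basis_mx U))).

Lemma tensvP U V M : M \in tensv U V <-> tensor U V M.
Proof.
rewrite tensorP; split=> [/memv_imgP[X _ ->]|[X ->]]; first by exists X; rewrite lfunE.
by apply/memv_imgP; exists X; rewrite ?memvf// lfunE.
Qed.

Lemma dim_tensv U V : (\dim (tensv U V) <= \dim U * \dim V)%N.
Proof.
apply: (@leq_trans (\dim {:'M[K]_(\dim U, \dim V)})); last by rewrite dimvf leqnn.
by rewrite -[X in (_ <= X)%N](limg_ker_dim (linfun (mulmxr (basis_mx V)^T \o mulmx (basis_mx U)))) leq_addl.
Qed.

End Tensor.

Section TensorMaps.
Variables (K : fieldType) (p q : nat).
Implicit Types (U : {vspace 'cV[K]_p}) (V : {vspace 'cV[K]_q}).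

Lemma tensor_img U V m (N : 'M[K]_(m, p)) M :
  tensor U V M -> tensor (mulmxv N U) V (N *m M).
Proof.
move=> [MU MV]; split; first by rewrite colspaceM mulmxvS.
by rewrite /rowspace trmx_mul (subv_trans (colspaceMl _ _)).
Qed.

(** A basis of the image space [mulmxv N U] factors through [N], and the coefficients of [M] are
    carried along. *)
Lemma tensor_preimg U V m (N : 'M[K]_(m, p)) M :
  tensor (mulmxv N U) V M -> exists2 H, tensor U V H & M = N *m H.
Proof.
move=> /tensorP[X ->].
have /colspace_sub[Y YE] :
    (colspace (basis_mx (mulmxv N U)) <= colspace (N *m basis_mx U))%VS.
  by rewrite colspaceM !colspace_basis_mx.
exists (basis_mx U *m (Y *m X) *m (basis_mx V)^T); first by apply/tensorP; exists (Y *m X).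
by rewrite YE -!mulmxA.
Qed.

Lemma tensor_trP U V M : tensor U V M <-> tensor V U M^T.
Proof. by split=> -[MU MV]; split; move: MU MV; rewrite /rowspace ?trmxK. Qed.

End TensorMaps.

Section TensorPair.
Variables (K : fieldType) (p q : nat).
Implicit Types (U : {vspace 'cV[K]_p}) (V : {vspace 'cV[K]_q}).

Lemma tensor_imgr U V m (N : 'M[K]_(q, m)) M :
  tensor U V M -> tensor U (mulmxv N^T V) (M *m N).
Proof. by move=> /tensor_trP/(tensor_img N^T) h; apply/tensor_trP; rewrite trmx_mul. Qed.

Lemma tensor_preimgr U V m (N : 'M[K]_(q, m)) M :
  tensor U (mulmxv N^T V) M -> exists2 H, tensor U V H & M = H *m N.
Proof.
move=> /tensor_trP/tensor_preimg[H HU ME]; exists H^T; first by apply/tensor_trP; rewrite trmxK.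
by rewrite -[LHS]trmxK ME trmx_mul !trmxK.
Qed.

Lemma tensor_null U V m (N : 'M[K]_(m, p)) M :
  (U <= nullspace N)%VS -> tensor U V M -> N *m M = 0.
Proof.
move=> UN [MU _]; apply/matrixP => i j.
have : M *m delta_mx j 0 \in nullspace N.
  exact: (subvP UN _ (subvP MU _ (memv_colspace _ _))).
rewrite nullspaceE mulmxA => /eqP/colP/(_ i).
by rewrite -colE !mxE.
Qed.

End TensorPair.

Section TensorSums.
Variables (K : fieldType) (p q : nat).
Implicit Types (U : {vspace 'cV[K]_p}) (V : {vspace 'cV[K]_q}).

Lemma tensor_nullr U V m (N : 'M[K]_(q, m)) M :
  (V <= nullspace N^T)%VS -> tensor U V M -> M *m N = 0.
Proof.
move=> VN /tensor_trP/(tensor_null VN) MN0; apply: trmx_inj.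
by rewrite trmx_mul trmx0.
Qed.

(** Splits every unit vector along the spanning family and uses the pieces as columns: a
    decomposition of the identity subordinate to the family. *)
Lemma full_sum_id (n : nat) (I : finType) (P : pred I) (U : I -> {vspace 'cV[K]_n}) :
  (\sum_(i | P i) U i)%VS = fullv ->
  exists2 f : I -> 'M[K]_n, forall i, P i -> (colspace (f i) <= U i)%VS
    & \sum_(i | P i) f i = 1%:M.
Proof.
move=> Uf.
have /choice[w wP] (c : 'I_n) : exists w : I -> 'cV[K]_n,
    (forall i, P i -> w i \in U i) /\ delta_mx c 0 = \sum_(i | P i) w i.
  have /memv_sumP[w wU wE] : delta_mx c 0 \in (\sum_(i | P i) U i)%VS.
    by rewrite Uf memvf.
  by exists w.
exists (fun i => \matrix_(r, c) w c i r 0) => [i Pi|].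
  apply/subvP => _ /colspaceP[x ->].
  rewrite (_ : _ *m x = \sum_c x c 0 *: w c i).
    by apply: rpred_sum => c _; rewrite memvZ//; apply: (wP c).1.
  apply/colP => r; rewrite mxE summxE; apply: eq_bigr => c _.
  by rewrite !mxE mulrC.
apply/matrixP => r c; rewrite summxE mxE.
have [_ /colP/(_ r)] := wP c; rewrite !mxE summxE eqxx andbT => ->.
by apply: eq_bigr => i _; rewrite mxE.
Qed.

(** Two decompositions of the identity are inserted, one on each side of [M]. *)
Lemma tensor_sum (I J : finType) (P : pred I) (Q : pred J)
    (U : I -> {vspace 'cV[K]_p}) (V : J -> {vspace 'cV[K]_q}) :
  (\sum_(i | P i) U i)%VS = fullv -> (\sum_(j | Q j) V j)%VS = fullv ->
  forall M, exists2 X : I -> J -> 'M[K]_(p, q),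
    forall i j, P i -> Q j -> tensor (U i) (V j) (X i j)
    & M = \sum_(i | P i) \sum_(j | Q j) X i j.
Proof.
move=> /full_sum_id[f fU f1] /full_sum_id[g gV g1] M.
exists (fun i j => f i *m M *m (g j)^T) => [i j Pi Qj|].
  split; first by rewrite -mulmxA (subv_trans (colspaceMl _ _)) ?fU.
  by rewrite /rowspace trmx_mul trmxK (subv_trans (colspaceMl _ _)) ?gV.
rewrite -[LHS]mul1mx -f1 mulmx_suml; apply: eq_bigr => i _.
rewrite -[LHS]mulmx1 -trmx1 -g1 raddf_sum mulmx_sumr.
by apply: eq_bigr.
Qed.

Lemma img_tensorE (E : vectType K) (f : {linear 'M[K]_(p, q) -> E}) U V :
  [set f M | M in tensor U V]%classic = [set` (linfun f @: tensv U V)%VS].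
Proof.
apply/seteqP; split=> v /=.
  by case=> M /tensvP MUV <-; rewrite -[f M]lfunE memv_img.
by case/memv_imgP=> M /tensvP MUV ->; exists M => //; rewrite lfunE.
Qed.

Lemma dim_img_tensv (E : vectType K) (f : {linear 'M[K]_(p, q) -> E}) U V :
  (\dim (linfun f @: tensv U V) <= \dim U * \dim V)%N.
Proof.
apply: leq_trans (dim_tensv U V).
by rewrite -[X in (_ <= X)%N](limg_ker_dim (linfun f)) leq_addl.
Qed.

End TensorSums.

(** * Two direct decompositions of the weight space *)

Section Families.
Variables (R : realType) (L : nat) (d : nat -> nat).
Local Notation weights := 'rV[R]_(\sum_(j < L) d j.+1 * d j)%N.

Lemma layerE (v : weights) j :
  layer v j = @unpack R L (fun j => d j.+1) d j v.
Proof. by []. Qed.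

Lemma layerD (u v : weights) j : layer (u + v) j = layer u j + layer v j.
Proof. by rewrite !layerE linearD. Qed.

Lemma layerB (u v : weights) j : layer (u - v) j = layer u j - layer v j.
Proof. by rewrite !layerE linearB. Qed.

Lemma layerZ c (u : weights) j : layer (c *: u) j = c *: layer u j.
Proof. by rewrite !layerE linearZ. Qed.

Lemma layer0 j : layer (0 : weights) j = 0.
Proof. by rewrite layerE linear0. Qed.

Lemma layer_sum (I : Type) (s : seq I) P (F : I -> weights) j :
  layer (\sum_(i <- s | P i) F i) j = \sum_(i <- s | P i) layer (F i) j.
Proof. by rewrite layerE raddf_sum. Qed.

Lemma layer_inj (u v : weights) :
  (forall j, (j < L)%N -> layer u j = layer v j) -> u = v.
Proof. exact: (@unpack_inj R L (fun j => d j.+1) d). Qed.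

Lemma layer_out (v : weights) j : (L <= j)%N -> layer v j = 0.
Proof. by move=> Lj; rewrite layerE unpack_out. Qed.

Lemma at_layer_in j (M : 'M[R]_(d j.+1, d j)) : (j < L)%N ->
  layer (at_layer L M) j = M.
Proof. by move=> jL; rewrite of_layersK// dfwithin. Qed.

Lemma at_layer_out j (M : 'M[R]_(d j.+1, d j)) s : s != j ->
  layer (at_layer L M) s = 0.
Proof.
move=> sj; have [sL|Ls] := ltnP s L; last exact: layer_out.
by rewrite of_layersK// dfwithout// eq_sym.
Qed.

Fact at_layer_is_linear j : linear (@at_layer R L d j).
Proof.
move=> c M N; apply: layer_inj => s sL; rewrite layerD layerZ.
have [->|sj] := eqVneq s j; last by rewrite !at_layer_out// scaler0 addr0.
have [jL|Lj] := ltnP j L; first by rewrite !at_layer_in.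
by rewrite !layer_out// scaler0 addr0.
Qed.
HB.instance Definition _ j :=
  GRing.isLinear.Build R 'M[R]_(d j.+1, d j) weights *:%R
    (@at_layer R L d j) (@at_layer_is_linear j).

Lemma of_layers_sum (X : forall j, 'M[R]_(d j.+1, d j)) :
  of_layers L X = \sum_(j < L) at_layer L (X j).
Proof.
apply: layer_inj => s sL; rewrite of_layersK// layer_sum.
rewrite (bigD1 (Ordinal sL))//= at_layer_in// big1 ?addr0// => j js.
by rewrite at_layer_out//; apply: contra_neq js => sj; apply/val_inj.
Qed.

Lemma weights_sum (v : weights) : v = \sum_(j < L) at_layer L (layer v j).
Proof. by rewrite -of_layers_sum layerK. Qed.

Variable theta : weights.
Local Notation sp := (subprod theta).
Local Notation lay := (layer theta).

Definition tau_map j (H : 'M[R]_(d j.+1)) : weights :=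
  at_layer L (lay j.+1 *m H) - at_layer L (H *m lay j).

Fact tau_map_is_linear j : linear (@tau_map j).
Proof.
move=> c M N; rewrite /tau_map mulmxDr mulmxDl -scalemxAr -scalemxAl.
by rewrite 2!linearD 2!linearZ /= scalerBr opprD addrACA.
Qed.
HB.instance Definition _ j :=
  GRing.isLinear.Build R 'M[R]_(d j.+1) weights *:%R
    (@tau_map j) (@tau_map_is_linear j).

Definition psi_map l k i h (M : 'M[R]_(d l, d h)) : weights :=
  of_layers L (psi_layers theta k i M).

Fact psi_map_is_linear l k i h : linear (@psi_map l k i h).
Proof.
move=> c M N; apply: layer_inj => s sL; rewrite layerD layerZ !of_layersK//.
rewrite /psi_layers; case: ifP => _; last by rewrite scaler0 addr0.
by rewrite mulmxDr mulmxDl -scalemxAr -scalemxAl.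
Qed.
HB.instance Definition _ l k i h :=
  GRing.isLinear.Build R 'M[R]_(d l, d h) weights *:%R
    (@psi_map l k i h) (@psi_map_is_linear l k i h).

Variables a b : forall k j i : nat, {vspace 'cV[R]_(d j)}.
Hypothesis flow_ab : flow_prebasis theta a b.

Lemma dim_a k j i : (i <= j <= k)%N -> (k <= L)%N -> \dim (a k j i) = mult theta k i.
Proof. by move=> ijk kL; have [aP _ _ _] := flow_ab; apply: dim_flow_a (aP _ _ _ ijk kL). Qed.

Lemma dim_b k j i : (i <= j <= k)%N -> (k <= L)%N -> \dim (b k j i) = mult theta k i.
Proof. by move=> ijk kL; have [_ bP _ _] := flow_ab; apply: dim_flow_b (bP _ _ _ ijk kL). Qed.

Lemma sum_a j : (j <= L)%N ->
  (\sum_(p : 'I_L.+1 * 'I_L.+1 | (p.2 <= j <= p.1)%N) a p.1 j p.2)%VS = fullv.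
Proof.
have [aP _ _ _] := flow_ab => jL; apply: (@flow_spanA _ _ _ theta j (fun k i => a k j i)) => //.
by move=> k i ijk kL; have [<- _] := aP _ _ _ ijk kL; rewrite subvv.
Qed.

Lemma sum_b j : (j <= L)%N ->
  (\sum_(p : 'I_L.+1 * 'I_L.+1 | (p.2 <= j <= p.1)%N) b p.1 j p.2)%VS = fullv.
Proof.
have [_ bP _ _] := flow_ab => jL; apply: (@flow_spanB _ _ _ theta j (fun k i => b k j i)) => //.
by move=> k i ijk kL; have [<- _] := bP _ _ _ ijk kL; rewrite subvv.
Qed.

Lemma flow_a_subprod k j i : (i <= j <= k)%N -> (k <= L)%N ->
  a k j i = mulmxv (sp j i) (a k i i).
Proof.
have [_ _ aE _] := flow_ab => /andP[ij jk] kL.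
elim: j ij jk => [|j IH] ij jk.
  by move: ij; rewrite leqn0 => /eqP ->; rewrite subprod_id mulmxv1.
move: ij; rewrite leq_eqVlt => /orP[/eqP->|ij]; first by rewrite subprod_id mulmxv1.
rewrite aE; [|lia..].
by rewrite IH ?(ltnW jk)// subprodS// mulmxvM.
Qed.

Lemma flow_b_subprod k j i : (i <= j <= k)%N -> (k <= L)%N ->
  b k j i = mulmxv (sp k j)^T (b k k i).
Proof.
have [_ _ _ bE] := flow_ab => /andP[ij jk] kL.
have [n] := ubnP (k - j); elim: n j ij jk => // n IH j ij jk kn.
move: jk; rewrite leq_eqVlt => /orP[/eqP->|jk]; first by rewrite subprod_id trmx1 mulmxv1.
rewrite bE; [|lia..].
rewrite IH; [|lia..].
by rewrite -mulmxvM -trmx_mul -subprodSr.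
Qed.

Lemma tensor_succ l k j i h (H : 'M[R]_(d j)) :
  (i <= j < l)%N -> (l <= L)%N -> tensor (a l j i) (b k j h) H ->
  tensor (a l j.+1 i) (b k j h) (lay j *m H).
Proof. by have [_ _ aE _] := flow_ab => ijl lL; rewrite (aE l j)//; apply: tensor_img. Qed.

Lemma tensor_lift l k j i h (M : 'M[R]_(d j.+1, d j)) :
  (h <= j < k)%N -> (k <= L)%N -> tensor (a l j.+1 i) (b k j h) M ->
  exists2 H, tensor (a l j.+1 i) (b k j.+1 h) H & M = H *m lay j.
Proof. by have [_ _ _ bE] := flow_ab => hjk kL; rewrite (bE k j)//; apply: tensor_preimgr. Qed.

Lemma tensor_lower l k j i h (M : 'M[R]_(d j.+1, d j)) :
  (i <= j < l)%N -> (l <= L)%N -> tensor (a l j.+1 i) (b k j h) M ->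
  exists2 H, tensor (a l j i) (b k j h) H & M = lay j *m H.
Proof. by have [_ _ aE _] := flow_ab => ijl lL; rewrite (aE l j)//; apply: tensor_preimg. Qed.

Lemma tensor_pred l k j i h (H : 'M[R]_(d j.+1)) :
  (h <= j < k)%N -> (k <= L)%N -> tensor (a l j.+1 i) (b k j.+1 h) H ->
  tensor (a l j.+1 i) (b k j h) (H *m lay j).
Proof. by have [_ _ _ bE] := flow_ab => hjk kL; rewrite (bE k j)//; apply: tensor_imgr. Qed.

(* For fixed (l, k, i, h) the phi_lkjih, with j running over the admissible
   layers, form a chain whose neighbours are linked by the tau_lkjih.  They all
   lie in the tangent space unless the block is open; in that case only the taus
   do, one fewer than there are layers, and psi_lkih makes up for the last one. *)
Definition open_block l k i h :=
  ((l == L) && (h == 0%N)) || ((k < l) && (h < i))%N.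

Definition valid_block l k j i h := ((i <= j.+1 <= l) && (h <= j <= k))%N.

(* Besides the members of Theta_strat (of Psi_strat) these two families have, at
   the indices of the other set, one-layer subspaces that complete them to
   families spanning the weight space. *)
Definition tangent_member l k j i h : {vspace weights} :=
  if open_block l k i h && (j < minn k L.-1)%N
  then (linfun (@tau_map j) @: tensv (a l j.+1 i) (b k j.+1 h))%VS
  else (linfun (@at_layer R L d j) @: tensv (a l j.+1 i) (b k j h))%VS.

Definition normal_member l k j i h : {vspace weights} :=
  if open_block l k i h && (j == minn k L.-1)
  then (linfun (@psi_map l k i h) @: tensv (b l l i) (a k h h))%VS
  else (linfun (@at_layer R L d j) @: tensv (b l j.+1 i) (a k j h))%VS.

Local Notation Idx := ('I_L * (('I_L.+1 * 'I_L.+1) * ('I_L.+1 * 'I_L.+1)))%type.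

Definition valid_index (x : Idx) := valid_block x.2.1.1 x.2.2.1 x.1 x.2.1.2 x.2.2.2.
(** The layers [j] of a block are bounded above by [k] and by [l.-1]. In an open block [l = L] or
    [k < l], and in both cases the smaller bound is [minn k L.-1]. *)
Definition last_in_block (x : Idx) :=
  open_block x.2.1.1 x.2.2.1 x.2.1.2 x.2.2.2 && (x.1 == minn x.2.2.1 L.-1 :> nat).
Definition index_mult (x : Idx) :=
  (mult theta x.2.1.1 x.2.1.2 * mult theta x.2.2.1 x.2.2.2)%N.

(** Padding by zero at inadmissible indices lets the sums run over a whole finite type. *)
Definition tangent_family (x : Idx) : {vspace weights} :=
  if valid_index x then tangent_member x.2.1.1 x.2.2.1 x.1 x.2.1.2 x.2.2.2 else 0%VS.
Definition normal_family (x : Idx) : {vspace weights} :=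
  if valid_index x then normal_member x.2.1.1 x.2.2.1 x.1 x.2.1.2 x.2.2.2 else 0%VS.

Lemma valid_index_ex l k j i h : valid_block l k j i h -> (l <= L)%N -> (k <= L)%N ->
  exists2 x : Idx, valid_index x &
    [/\ x.2.1.1 = l :> nat, x.2.2.1 = k :> nat, x.1 = j :> nat,
        x.2.1.2 = i :> nat & x.2.2.2 = h :> nat].
Proof.
rewrite /valid_index /valid_block => v lL kL.
have [jL iL hL] : [/\ j < L, i < L.+1 & h < L.+1]%N by split; lia.
rewrite -ltnS in lL; rewrite -ltnS in kL.
by exists (Ordinal jL, ((Ordinal lL, Ordinal iL), (Ordinal kL, Ordinal hL))).
Qed.

Lemma tangent_member_sub l k j i h : valid_block l k j i h -> (l <= L)%N -> (k <= L)%N ->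
  (tangent_member l k j i h <= \sum_x tangent_family x)%VS.
Proof.
move=> v lL kL; have [x vx [<- <- <- <- <-]] := valid_index_ex v lL kL.
by apply: (sumv_sup x) => //; rewrite /tangent_family vx subvv.
Qed.

Lemma normal_member_sub l k j i h : valid_block l k j i h -> (l <= L)%N -> (k <= L)%N ->
  (normal_member l k j i h <= \sum_x normal_family x)%VS.
Proof.
move=> v lL kL; have [x vx [<- <- <- <- <-]] := valid_index_ex v lL kL.
by apply: (sumv_sup x) => //; rewrite /normal_family vx subvv.
Qed.

(** In an open block, a matrix in a layer before the last has the form [H *m lay j]. Modulo
    [tau_map H] it can be traded for [lay j.+1 *m H] one layer higher, until the last layer is
    reached, where the one-layer subspace itself is a member. *)
Lemma phi_mem_tangent_family l k j i h M : valid_block l k j i h -> (l <= L)%N -> (k <= L)%N ->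
  tensor (a l j.+1 i) (b k j h) M -> at_layer L M \in (\sum_x tangent_family x)%VS.
Proof.
move=> + lL kL; have [n] := ubnP (k - j); elim: n j M => // n IH j M kn v Mab.
have := tangent_member_sub v lL kL; rewrite /tangent_member; case: ifPn => [|_ /subvP]; last first.
  by apply; apply/memv_imgP; exists M; [apply/tensvP|rewrite lfunE].
rewrite /open_block => jo /subvP tauF; move: v; rewrite /valid_block => v.
have [|H Hab ME] := tensor_lift _ kL Mab; first by lia.
have -> : at_layer L M = at_layer L (lay j.+1 *m H) - tau_map H.
  by rewrite /tau_map opprB addrC subrK ME.
rewrite memvB//.
  by apply: IH; rewrite /valid_block; [lia..|apply: tensor_succ => //; lia].
by apply: tauF; apply/memv_imgP; exists H; [apply/tensvP|rewrite lfunE].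
Qed.

Lemma psi_layer_tensor l k j i h M : (i <= j.+1 <= l)%N -> (h <= j <= k)%N ->
  (l <= L)%N -> (k <= L)%N -> tensor (b l l i) (a k h h) M ->
  tensor (b l j.+1 i) (a k j h) ((sp l j.+1)^T *m M *m (sp j h)^T).
Proof.
move=> ijl hjk lL kL Mab.
rewrite (flow_b_subprod ijl lL) (flow_a_subprod hjk kL) -{1}[sp j h]trmxK.
exact/tensor_imgr/tensor_img.
Qed.

Lemma psi_layer_lift l k j i h M : (i <= j.+1 <= l)%N -> (h <= j <= k)%N ->
  (l <= L)%N -> (k <= L)%N -> tensor (b l j.+1 i) (a k j h) M ->
  exists2 M0, tensor (b l l i) (a k h h) M0
    & M = (sp l j.+1)^T *m M0 *m (sp j h)^T.
Proof.
move=> ijl hjk lL kL.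
rewrite (flow_b_subprod ijl lL) (flow_a_subprod hjk kL) -{1}[sp j h]trmxK.
by move=> /tensor_preimgr[_ /tensor_preimg[M0 M0ab ->] ->]; exists M0.
Qed.

(** The last layer of an open block is the only one without a one-layer member. There [M] extends to
    a full chain [psi_map k i M0], whose other layers are members and are subtracted. *)
Lemma phi_mem_normal_family l k j i h M : valid_block l k j i h -> (l <= L)%N -> (k <= L)%N ->
  tensor (b l j.+1 i) (a k j h) M -> at_layer L M \in (\sum_x normal_family x)%VS.
Proof.
move=> + lL kL; have memG s N : valid_block l k s i h ->
    open_block l k i h && (s == minn k L.-1) = false ->
    tensor (b l s.+1 i) (a k s h) N -> at_layer L N \in (\sum_x normal_family x)%VS.
  move=> v ns Nab; apply: (subvP (normal_member_sub v lL kL)); rewrite /normal_member ns.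
  by apply/memv_imgP; exists N; [apply/tensvP|rewrite lfunE].
case jo : (open_block l k i h && (j == minn k L.-1)) => v; last exact: memG.
have /andP[ijl hjk] := v; have jL : (j < L)%N by lia.
move=> /(psi_layer_lift ijl hjk lL kL)[M0 M0ab ME].
have -> : at_layer L M =
    psi_map k i M0 - \sum_(s < L | s != Ordinal jL) at_layer L (psi_layers theta k i M0 s).
  rewrite /psi_map of_layers_sum [X in X - _](bigD1 (Ordinal jL))//= addrK /psi_layers.
  by rewrite ifT -?ME//; lia.
rewrite memvB//.
  apply: (subvP (normal_member_sub v lL kL)); rewrite /normal_member jo.
  by apply/memv_imgP; exists M0; [apply/tensvP|rewrite lfunE].
apply: rpred_sum => s sj; rewrite /psi_layers; case: ifP => isk; last first.
  by rewrite linear0 mem0v.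
have {}sj : (s : nat) != j by apply: contra_neq sj => sj; apply: val_inj.
have sL := ltn_ord s; move: jo; rewrite /open_block => jo.
apply: memG; rewrite /open_block /valid_block; [lia..|].
by apply: psi_layer_tensor => //; lia.
Qed.

Lemma full_family (X : Idx -> {vspace weights})
    (U V : forall l j i : nat, {vspace 'cV[R]_(d j)}) :
  (forall j, (j <= L)%N ->
    (\sum_(p : 'I_L.+1 * 'I_L.+1 | (p.2 <= j <= p.1)%N) U p.1 j p.2)%VS = fullv) ->
  (forall j, (j <= L)%N ->
    (\sum_(p : 'I_L.+1 * 'I_L.+1 | (p.2 <= j <= p.1)%N) V p.1 j p.2)%VS = fullv) ->
  (forall l k j i h M, valid_block l k j i h -> (l <= L)%N -> (k <= L)%N ->
    tensor (U l j.+1 i) (V k j h) M -> at_layer L M \in (\sum_x X x)%VS) ->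
  (\sum_x X x)%VS = fullv.
Proof.
move=> Uf Vf memX; apply/eqP; rewrite eqEsubv subvf /=; apply/subvP => v _.
rewrite (weights_sum v); apply: rpred_sum => j _.
have [X0 X0UV ->] := tensor_sum (Uf _ (ltn_ord j)) (Vf _ (ltnW (ltn_ord j))) (layer v j).
rewrite raddf_sum; apply: rpred_sum => -[l i] /= lij.
rewrite raddf_sum; apply: rpred_sum => -[k h] /= khj.
apply: (memX l k j i h); rewrite ?leq_ord//; first by rewrite /valid_block lij khj.
exact: X0UV.
Qed.

(** In each layer the intervals on the two sides vary independently, so the sum factors into
    [d j.+1 * d j]. *)
Lemma sum_index_mult : (\sum_(x | valid_index x) index_mult x = \dim {:weights})%N.
Proof.
rewrite dimvf /dim/= mul1n.
rewrite -(pair_big_dep xpredT (fun (j : 'I_L) (y : ('I_L.+1 * 'I_L.+1) * ('I_L.+1 * 'I_L.+1)) =>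
   ((y.1.2 <= j.+1 <= y.1.1) && (y.2.2 <= j <= y.2.1))%N)
   (fun j y => mult theta y.1.1 y.1.2 * mult theta y.2.1 y.2.2)%N) /=.
apply: eq_bigr => j _.
rewrite -(pair_big (fun p : 'I_L.+1 * 'I_L.+1 => (p.2 <= j.+1 <= p.1)%N)
  (fun p : 'I_L.+1 * 'I_L.+1 => (p.2 <= j <= p.1)%N)
  (fun p q => mult theta p.1 p.2 * mult theta q.1 q.2)%N) /=.
by rewrite -big_distrlr /= !sum_mult// ltnW.
Qed.

Lemma directv_tangent_family : directv (\sum_x tangent_family x) /\
  forall x, \dim (tangent_family x) = if valid_index x then index_mult x else 0%N.
Proof.
apply: directv_dim_bound; last by rewrite -big_mkcond sum_index_mult.
- move=> x; rewrite /tangent_family; case: ifP => [v|_]; last by rewrite dimv0.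
  have lL := leq_ord x.2.1.1; have kL := leq_ord x.2.2.1.
  move: v; rewrite /valid_index /valid_block /tangent_member /index_mult => v; case: ifP => jo.
    rewrite (leq_trans (dim_img_tensv _ _ _))//.
    by rewrite dim_a ?dim_b//; lia.
  rewrite (leq_trans (dim_img_tensv _ _ _))//.
  by rewrite dim_a ?dim_b//; lia.
- exact: (full_family sum_a sum_b phi_mem_tangent_family).
Qed.

Lemma directv_normal_family : directv (\sum_x normal_family x) /\
  forall x, \dim (normal_family x) = if valid_index x then index_mult x else 0%N.
Proof.
apply: directv_dim_bound; last by rewrite -big_mkcond sum_index_mult.
- move=> x; rewrite /normal_family; case: ifP => [v|_]; last by rewrite dimv0.
  have lL := leq_ord x.2.1.1; have kL := leq_ord x.2.2.1.
  move: v; rewrite /valid_index /valid_block /normal_member /index_mult => v; case: ifP => jo.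
    rewrite (leq_trans (dim_img_tensv _ _ _))//.
    by rewrite dim_a ?dim_b//; lia.
  rewrite (leq_trans (dim_img_tensv _ _ _))//.
  by rewrite dim_a ?dim_b//; lia.
- exact: (full_family sum_b sum_a phi_mem_normal_family).
Qed.

End Families.

(** * The families of the theorem and their dimensions *)

Section Stratum.
Variables (R : realType) (L : nat) (d : nat -> nat).
Hypothesis L_ge1 : (1 <= L)%N.
Local Notation weights := 'rV[R]_(\sum_(j < L) d j.+1 * d j)%N.
Local Notation Idx := ('I_L * (('I_L.+1 * 'I_L.+1) * ('I_L.+1 * 'I_L.+1)))%type.
Variable theta : weights.
Variables a b : forall k j i : nat, {vspace 'cV[R]_(d j)}.
Hypothesis flow_ab : flow_prebasis theta a b.
Local Notation F := (tangent_family theta a b).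
Local Notation G := (normal_family theta a b).

(** The conditions on phi are the negation of openness and those on tau amount to openness. The
    range of a tau, which needs two consecutive layers, is [j < minn k L.-1]. *)
Lemma Theta_stratE sigma :
  Theta_strat theta a b sigma <-> sigma <> [set 0] /\
    exists2 x : Idx, valid_index x && ~~ last_in_block x & sigma = [set` F x].
Proof.
split.
- case=> -[s0 [l [k [j [i [h [[ijl lL] [hjk kL] c1 c2]]]]]]].
    move=> sE; split => //; rewrite sE.
    have v : valid_block l k j i h by rewrite /valid_block ijl hjk.
    have no : open_block L l k i h = false by rewrite /open_block; lia.
    have [x vx [xl xk xj xi xh]] := valid_index_ex v lL kL.
    exists x; first by rewrite vx /last_in_block xl xk xi xh no.
    by rewrite /tangent_family vx xl xk xj xi xh /tangent_member no /= -img_tensorE.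
  split => //; rewrite c2.
  have v : valid_block l k j i h by rewrite /valid_block; lia.
  have o : open_block L l k i h by rewrite /open_block; lia.
  have jm : (j < minn k L.-1)%N by lia.
  have [x vx [xl xk xj xi xh]] := valid_index_ex v lL kL.
  exists x; first by rewrite vx /last_in_block xl xk xi xh xj; lia.
  by rewrite /tangent_family vx xl xk xj xi xh /tangent_member o jm -img_tensorE.
- case=> s0 [x /andP[vx nx] sE]; move: nx sE.
  rewrite /tangent_family vx; move: vx; rewrite /valid_index /last_in_block.
  move: (leq_ord x.2.1.1) (leq_ord x.2.2.1) (ltn_ord x.1).
  case: x => -[j jL] [[[l ?] [i ?]] [[k ?] [h ?]]] /= {jL} lL kL jL.
  rewrite /valid_block /tangent_member => v no; case: ifPn => jo; rewrite -img_tensorE => sE.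
    right; split=> //; exists l, k, j, i, h.
    by move: no jo; rewrite /open_block => no jo; split=> //; lia.
  left; split=> //; exists l, k, j, i, h.
  by move: no jo; rewrite /open_block => no jo; split=> //; lia.
Qed.

Lemma Psi_stratE sigma :
  Psi_strat theta a b sigma <-> sigma <> [set 0] /\
    exists2 x : Idx, valid_index x && last_in_block x & sigma = [set` G x].
Proof.
split.
- have main l k i h : (l <= L)%N -> (k <= L)%N -> sigma = psi theta a b l k i h ->
      open_block L l k i h -> (i <= k.+1)%N -> (h <= k)%N -> (i <= L)%N ->
      exists2 x : Idx, valid_index x && last_in_block x & sigma = [set` G x].
    (* A psi spreads over several layers; the last layer of its block is the index that represents
       it. *)
    move=> lL kL sE o ik hk iL; pose j := minn k L.-1.
    have v : valid_block l k j i h by move: o; rewrite /open_block /valid_block /j; lia.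
    have [x vx [xl xk xj xi xh]] := valid_index_ex v lL kL.
    exists x; first by rewrite vx /last_in_block xl xk xi xh xj o /= eqxx.
    by rewrite /normal_family vx xl xk xj xi xh /normal_member o eqxx -img_tensorE sE.
  case=> -[s0].
    move=> [k [i [kL iL ik sE]]]; split=> //.
    by apply: (main _ _ _ _ _ _ sE); rewrite /open_block; lia.
  move=> [l [k [i [h [hik kl hk sE]]]]]; split=> //.
  by apply: (main _ _ _ _ _ _ sE); rewrite /open_block; lia.
- case=> s0 [x /andP[vx nx] sE]; move: nx sE.
  rewrite /normal_family vx; move: vx; rewrite /valid_index /last_in_block.
  move: (leq_ord x.2.1.1) (leq_ord x.2.2.1) (ltn_ord x.1).
  case: x => -[j jL] [[[l ?] [i ?]] [[k ?] [h ?]]] /= {jL} lL kL jL.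
  rewrite /valid_block /normal_member => v no; rewrite no -img_tensorE => sE.
  move: no => /andP[/orP[/andP[/eqP lE /eqP hE]|kl] jm].
    left; split=> //; exists k, i; subst l h; split=> //; lia.
  right; split=> //; exists l, k, i, h; split=> //; lia.
Qed.

Definition theta_span : {vspace weights} := (\sum_(x : Idx | valid_index x && ~~ last_in_block x) F x)%VS.
Definition psi_span : {vspace weights} := (\sum_(x : Idx | valid_index x && last_in_block x) G x)%VS.

Lemma dim_theta_span : \dim theta_span = (\sum_(x : Idx | valid_index x && ~~ last_in_block x) index_mult theta x)%N.
Proof.
have [dF Fd] := directv_tangent_family flow_ab.
rewrite dim_directv_sum; last exact: directv_sub.
by apply: eq_bigr => x /andP[vx _]; rewrite Fd vx.
Qed.

Lemma dim_psi_span : \dim psi_span = (\sum_(x : Idx | valid_index x && last_in_block x) index_mult theta x)%N.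
Proof.
have [dG Gd] := directv_normal_family flow_ab.
rewrite dim_directv_sum; last exact: directv_sub.
by apply: eq_bigr => x /andP[vx _]; rewrite Gd vx.
Qed.

(** The two selections are complementary parts of one index set, and both families have dimension
    [index_mult] at each admissible index. *)
Lemma dim_theta_psi_span : (\dim theta_span + \dim psi_span = \dim {:weights})%N.
Proof.
by rewrite dim_theta_span dim_psi_span -(sum_index_mult theta) addnC [RHS](bigID (@last_in_block L)).
Qed.

Lemma prebasis_Theta V : V = [set` theta_span] -> prebasis (Theta_strat theta a b) V.
Proof.
apply: prebasis_directv => [sigma|]; first exact: Theta_stratE.
by apply: directv_sub; have [] := directv_tangent_family flow_ab.
Qed.

Lemma prebasis_Psi V : V = [set` psi_span] -> prebasis (Psi_strat theta a b) V.
Proof.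
apply: prebasis_directv => [sigma|]; first exact: Psi_stratE.
by apply: directv_sub; have [] := directv_normal_family flow_ab.
Qed.

Local Notation w k i := ((mult theta k i)%:Z).
Local Notation rz k i := ((\rank (subprod theta k i))%:Z).

(** An open block has a unique last layer, and that layer is admissible exactly when [i <= k.+1]. *)
Lemma sum_last :
  (\sum_(x : Idx | valid_index x && last_in_block x) index_mult theta x =
   \sum_(y : ('I_L.+1 * 'I_L.+1) * ('I_L.+1 * 'I_L.+1))
     if open_block L y.1.1 y.2.1 y.1.2 y.2.2 && (y.1.2 <= y.2.1.+1)
     then mult theta y.1.1 y.1.2 * mult theta y.2.1 y.2.2 else 0)%N.
Proof.
rewrite big_mkcond /= -(pair_bigA _ (fun j y =>
  if valid_index (j, y) && last_in_block (j, y) then index_mult theta (j, y) else 0%N)) /=.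
rewrite exchange_big; apply: eq_bigr => -[[l i] [k h]] _ /=.
rewrite /valid_index /last_in_block /index_mult /valid_block /=.
have [lL kL] := (leq_ord l, leq_ord k); have [iL hL] := (leq_ord i, leq_ord h).
case: ifP; rewrite /open_block => c.
  have jL : (minn k L.-1 < L)%N by lia.
  rewrite (bigD1 (Ordinal jL))//= ifT; last by lia.
  rewrite big1 ?addn0// => j; rewrite -val_eqE /= => jj.
  by rewrite ifF//; lia.
by rewrite big1// => j _; rewrite ifF//; lia.
Qed.

(** For [k < L] and [0 < i], openness reduces to [k < l] and [h < i], since [l = L] and [h = 0]
    satisfy both; the sum is then a product of two interval counts. If [k = L] or [i = 0], only
    [l = L], [h = 0] remains. *)
Lemma sum_block (k i : 'I_L.+1) :
  \sum_(l < L.+1) \sum_(h < L.+1)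
    (if open_block L l k i h && (i <= k.+1)%N then w l i * w k h else 0)
  = if (k < L)%N && (0 < i)%N then
      if (i <= k.+1)%N
      then (rz k.+1 i - rz k.+1 i.-1) * (rz k i.-1 - rz k.+1 i.-1) else 0
    else w L i * w k 0%N.
Proof.
have [iL kL] := (leq_ord i, leq_ord k).
case: ifP => [/andP[klt i0]|kiF].
  case: ifPn => [ik|ik]; last first.
    by rewrite big1// => l _; rewrite big1// => h _; rewrite andbF.
  have [i' iE] : exists i', i = i'.+1 :> nat by exists i.-1; lia.
  rewrite iE /= in ik *; rewrite ltnS in ik.
  have /= <- := @sum_mult_ge _ _ _ theta k.+1 i'.+1 ik klt.
  rewrite -(sum_mult_le theta ik kL) big_distrlr [RHS]big_mkcond /=.
  apply: eq_bigr => l _; have lL := leq_ord l; case: ifPn => kl.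
    rewrite [RHS]big_mkcond /=; apply: eq_bigr => h _; congr (if _ then _ else _).
    by rewrite /open_block; lia.
  rewrite big1// => h _; rewrite ifF// /open_block; lia.
rewrite (bigD1 ord_max)//= (bigD1 ord0)//= ifT; last by rewrite /open_block; lia.
rewrite big1 ?addr0; last first.
  move=> h; rewrite -val_eqE /= => h0.
  by rewrite ifF// /open_block; lia.
rewrite big1 ?addr0// => l; rewrite -val_eqE /= => lL; rewrite big1// => h _.
by have lL2 := leq_ord l; rewrite ifF// /open_block; lia.
Qed.

(** With r the rank of W, the blocks with [k = L] contribute r d_L. Those with [k < L] and [i = 0]
    contribute r (d_0 - r), because the intervals starting at 0 number d_0 and r of them reach [L].
    The other blocks give the double sum. *)
Lemma dim_psi_span_rank : (\dim psi_span)%:Z =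
  rz L 0%N * ((d L)%:Z + (d 0%N)%:Z - rz L 0%N)
  + \sum_(k < L) \sum_(1 <= i < k.+2)
      (rz k.+1 i - rz k.+1 i.-1) * (rz k i.-1 - rz k.+1 i.-1).
Proof.
transitivity (\sum_(k < L.+1) \sum_(i < L.+1) \sum_(l < L.+1) \sum_(h < L.+1)
    (if open_block L l k i h && (i <= k.+1)%N then w l i * w k h else 0)).
  rewrite dim_psi_span sum_last (big_morph Posz PoszD erefl).
  rewrite -(pair_bigA _ (fun p q : 'I_L.+1 * 'I_L.+1 => Posz
     (if open_block L p.1 q.1 p.2 q.2 && (p.2 <= q.1.+1)%N
     then mult theta p.1 p.2 * mult theta q.1 q.2 else 0)%N)) /=.
  rewrite exchange_big /=.
  rewrite -(pair_bigA _ (fun k h : 'I_L.+1 => \sum_(p : 'I_L.+1 * 'I_L.+1) Posz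
     (if open_block L p.1 k p.2 h && (p.2 <= k.+1)%N
     then mult theta p.1 p.2 * mult theta k h else 0)%N)) /=.
  apply: eq_bigr => k _.
  under eq_bigr => h _.
    rewrite -(pair_bigA _ (fun l i : 'I_L.+1 => Posz
     (if open_block L l k i h && (i <= k.+1)%N
     then mult theta l i * mult theta k h else 0)%N)) /= exchange_big /=; over.
  rewrite exchange_big /=; apply: eq_bigr => i _; rewrite exchange_big /=.
  by apply: eq_bigr => l _; apply: eq_bigr => h _; case: ifP.
under eq_bigr => k _ do under eq_bigr => i _ do rewrite sum_block.
have wL0 : w L 0%N = rz L 0%N.
  have := mult_rkz theta (leq0n L); rewrite !rk_top// ?rk_pred_top// /rk_pred.
  by rewrite !subr0.
have sumL : \sum_(i < L.+1) w L i = (d L)%:Z.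
  have := sum_mult_le theta (leqnn L) (leqnn L).
  rewrite rk_top// rk_diag subr0 => <-; apply: eq_bigl => i; exact/esym/leq_ord.
have sum0 : \sum_(k < L.+1) w k 0%N = (d 0%N)%:Z.
  by have := sum_mult_ge theta (leqnn 0) (leq0n L); rewrite rk_diag subr0.
rewrite big_ord_recr /= ltnn /=.
rewrite -mulr_suml sumL wL0.
rewrite (eq_bigr (fun k : 'I_L => w L 0%N * w k 0%N + \sum_(1 <= i < k.+2)
      (rz k.+1 i - rz k.+1 i.-1) * (rz k i.-1 - rz k.+1 i.-1))); last first.
  move=> k _; rewrite big_ord_recl /= ltn_ord /=; congr (_ + _).
  rewrite big_add1 /= (big_nat_widen _ _ L)//= big_mkord [RHS]big_mkcond /=.
  by apply: eq_bigr => i _; rewrite /bump leq0n add1n ltnS.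
rewrite big_split /= -mulr_sumr addrAC wL0; congr (_ + _).
move: sum0; rewrite big_ord_recr /= wL0 => <-; ring.
Qed.

Lemma dim_theta_span_Dstrat : (\dim theta_span)%:Z = Dstrat theta.
Proof.
rewrite /Dstrat -addrA -opprD -dim_psi_span_rank.
have -> : dtheta L d = (\dim theta_span + \dim psi_span)%N.
  by rewrite dim_theta_psi_span dimvf /dim /= mul1n.
by rewrite PoszD addrK.
Qed.

End Stratum.

(** * Orthogonal complements by dimension count *)

Section Orthogonal.
Variables (R : realType) (n : nat).
Implicit Types (u v : 'rV[R]_n).

Lemma dotmulC u v : dotmul u v = dotmul v u.
Proof. by apply: eq_bigr => i _; rewrite mulrC. Qed.

Lemma dotmulDl u v w : dotmul (u + v) w = dotmul u w + dotmul v w.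
Proof. by rewrite /dotmul -big_split; apply: eq_bigr => i _; rewrite mxE mulrDl. Qed.

Lemma dotmulDr u v w : dotmul w (u + v) = dotmul w u + dotmul w v.
Proof. by rewrite !(dotmulC w) dotmulDl. Qed.

Lemma dotmulZl x u w : dotmul (x *: u) w = x * dotmul u w.
Proof. by rewrite /dotmul mulr_sumr; apply: eq_bigr => i _; rewrite mxE mulrA. Qed.

Lemma dotmul0r u : dotmul u 0 = 0.
Proof. by rewrite /dotmul big1// => i _; rewrite mxE mulr0. Qed.

Lemma dotmul_eq0 u : dotmul u u = 0 -> u = 0.
Proof.
move/eqP; rewrite psumr_eq0 => [/allP u0|i _]; last by rewrite -expr2 sqr_ge0.
apply/rowP => i; rewrite mxE; apply/eqP.
by have := u0 i (mem_index_enum i); rewrite /= mulf_eq0 orbb.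
Qed.

(** [T] meets [B] trivially because the Euclidean product is definite. As [T] contains [A], the
    dimensions force [T + B] to be the whole space and [T] to have the dimension of [A]. *)
Lemma orthogonal_complement (A B T : {vspace 'rV[R]_n}) :
  (A <= T)%VS -> (forall u v, u \in T -> v \in B -> dotmul u v = 0) ->
  (\dim A + \dim B = \dim {:'rV[R]_n})%N ->
  [/\ T = A, forall v, (forall u, u \in T -> dotmul u v = 0) -> v \in B
    & forall u, (forall v, v \in B -> dotmul u v = 0) -> u \in T].
Proof.
move=> AT TB AB.
have TB0 : (T :&: B = 0)%VS.
  apply/eqP; rewrite -subv0; apply/subvP => v; rewrite memv_cap memv0.
  by case/andP=> vT vB; apply/eqP/dotmul_eq0/TB.
have dTB := dimv_disjoint_sum TB0.
have TBf : (T + B)%VS = fullv.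
  by apply/eqP; rewrite eqEdim subvf dTB -AB leq_add2r dimvS.
split=> [|v vT|u uB].
- apply/esym/eqP; rewrite eqEdim AT /= -(leq_add2r (\dim B)) AB -dTB.
  exact: dimvS (subvf _).
- have /memv_addP[t tT [w wB vE]] : v \in (T + B)%VS by rewrite TBf memvf.
  have := vT t tT; rewrite vE dotmulDr (TB t w)// addr0 => /dotmul_eq0 ->.
  by rewrite add0r.
- have /memv_addP[t tT [w wB uE]] : u \in (T + B)%VS by rewrite TBf memvf.
  have := uB w wB; rewrite uE dotmulDl (TB t w)// add0r => /dotmul_eq0 ->.
  by rewrite addr0.
Qed.

End Orthogonal.

(** * Base changes and isomorphisms of quiver representations *)

Section BasisChange.
Variables (K : fieldType) (n : nat) (I : finType) (P : pred I).

Lemma mulmx_span m (u : I -> 'cV[K]_n) (A B : 'M[K]_(m, n)) :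
  (\sum_(x | P x) <[u x]>)%VS = fullv ->
  (forall x, P x -> A *m u x = B *m u x) -> A = B.
Proof.
move=> uf AB; have AB0 (v : 'cV[K]_n) : A *m v = B *m v.
  have /memv_sumP[w wu ->] : v \in (\sum_(x | P x) <[u x]>)%VS by rewrite uf memvf.
  rewrite !mulmx_sumr; apply: eq_bigr => x Px.
  by have /vlineP[c ->] := wu x Px; rewrite -!scalemxAr AB.
by apply/matrixP => i j; have /colP/(_ i) := AB0 (delta_mx j 0); rewrite -!colE !mxE.
Qed.

(** As columns of a matrix, a spanning family with exactly [n] indices is invertible; [g] is a
    quotient of two such matrices. *)
Lemma basis_change (u v : I -> 'cV[K]_n) : #|P| = n ->
  (\sum_(x | P x) <[u x]>)%VS = fullv -> (\sum_(x | P x) <[v x]>)%VS = fullv ->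
  exists2 g : 'M[K]_n, g \in unitmx & forall x, P x -> g *m u x = v x.
Proof.
move=> Pn uf vf.
pose mx (w : I -> 'cV[K]_n) : 'M[K]_n :=
  \matrix_(r, c) w (enum_val (cast_ord (esym Pn) c)) r 0.
have mxw w x : P x -> exists c, w x = col c (mx w) /\
    forall w', w' x = col c (mx w').
  move=> Px; exists (cast_ord Pn (enum_rank_in Px x)).
  by split=> [|w']; apply/colP => r; rewrite !mxE cast_ordK enum_rankK_in.
have mxu w : (\sum_(x | P x) <[w x]>)%VS = fullv -> mx w \in unitmx.
  move=> wf; rewrite -row_free_unit /row_free -dim_colspace.
  suff -> : colspace (mx w) = fullv by rewrite dim_cV.
  apply/eqP; rewrite eqEsubv subvf -wf; apply/subv_sumP => x Px.
  by have [c [+ _]] := mxw w x Px; rewrite colE => wx; rewrite -memvE wx memv_colspace.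
exists (mx v *m invmx (mx u)); first by rewrite unitmx_mul unitmx_inv !mxu.
move=> x Px; have [c [-> /(_ v) ->]] := mxw u x Px.
by rewrite !colE mulmxA mulmxKV// mxu.
Qed.

End BasisChange.

Section Conjugation.
Variables (K : fieldType) (m n : nat).

Lemma conjugate_right (A B : 'M[K]_(m, n)) (G C H : 'M[K]_n) (G1 : 'M[K]_m) :
  G \in unitmx -> H \in unitmx -> A *m G = G1 *m B ->
  A *m C = G1 *m (B *m (invmx G *m C *m H)) *m invmx H.
Proof.
move=> Gu Hu AG.
by rewrite (mulmxA G1) -AG -!mulmxA (mulmxA G) mulmxV// mul1mx mulmxV// mulmx1.
Qed.

Lemma conjugate_left (A B : 'M[K]_(m, n)) (G1 C H1 : 'M[K]_m) (H : 'M[K]_n) :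
  G1 \in unitmx -> H \in unitmx -> A *m H = H1 *m B ->
  C *m A = G1 *m (invmx G1 *m C *m H1 *m B) *m invmx H.
Proof.
move=> Gu Hu AH.
by rewrite -(mulmxA _ H1) -AH !mulmxA mulmxV// mul1mx mulmxK.
Qed.

End Conjugation.

Section Gauge.
Variables (R : realType) (L : nat) (d : nat -> nat).
Local Notation weights := 'rV[R]_(\sum_(j < L) d j.+1 * d j)%N.
Local Notation gauge := 'rV[R]_(\sum_(j < L.+1) d j * d j)%N.
Local Notation gl := (@unpack R L.+1 d d).
Local Notation gpack := (@pack R L.+1 d d).
Implicit Types (p q : weights) (c : gauge).

Lemma unpackD j (u v : gauge) : gl j (u + v) = gl j u + gl j v.
Proof. exact: linearD. Qed.

Lemma unpackZ j x (u : gauge) : gl j (x *: u) = x *: gl j u.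
Proof. exact: linearZ. Qed.

(** For [q = p] this is minus the derivative at the identity of the action on [p]. For general [q]
    it vanishes exactly when [c] is a morphism from [p] to [q]. *)
Definition gauge_diff p q c : weights :=
  of_layers L (fun j => layer q j *m gl j c - gl j.+1 c *m layer p j).

Fact gauge_diff_is_linear p q : linear (gauge_diff p q).
Proof.
move=> x u v; apply: layer_inj => j jL; rewrite layerD layerZ !of_layersK//.
rewrite !unpackD !unpackZ mulmxDl mulmxDr -!scalemxAl -scalemxAr.
by rewrite scalerBr opprD addrACA.
Qed.
HB.instance Definition _ p q :=
  GRing.isLinear.Build R gauge weights *:%R (gauge_diff p q) (gauge_diff_is_linear p q).

Definition defect (W : 'M[R]_(d L, d 0%N)) c : 'M[R]_(d L, d 0%N) :=
  gl L c *m W - W *m gl 0%N c.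

Fact defect_is_linear W : linear (defect W).
Proof.
move=> x u v; rewrite /defect.
rewrite !unpackD !unpackZ mulmxDl mulmxDr -!scalemxAl -scalemxAr.
by rewrite scalerBr opprD addrACA.
Qed.
HB.instance Definition _ W :=
  GRing.isLinear.Build R gauge 'M[R]_(d L, d 0%N) *:%R (defect W)
    (defect_is_linear W).

(** The condition g_L W = W g_0 as a linear space of not necessarily invertible families: the Lie
    algebra of the stabilizer of [W]. *)
Definition fixing W : {vspace gauge} := lker (linfun (defect W)).

Lemma fixingE W c : (c \in fixing W) = (gl L c *m W == W *m gl 0%N c).
Proof. by rewrite memv_ker lfunE /= subr_eq0. Qed.

(** The case [q = p] is the candidate T for the tangent space. Distinct points occur in the charts,
    which compare the center [p] with a moving [q]. *)
Definition tangentv W p q : {vspace weights} := (linfun (gauge_diff p q) @: fixing W)%VS.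

Lemma tangentvP W p q v :
  reflect (exists2 c, c \in fixing W & v = gauge_diff p q c) (v \in tangentv W p q).
Proof. by apply: (iffP memv_imgP) => -[c cW ->]; exists c; rewrite ?lfunE. Qed.

Definition intertwines p q (g : forall j, 'M[R]_(d j)) :=
  forall j, (j < L)%N -> layer q j *m g j = g j.+1 *m layer p j.

Lemma intertwines_subprod p q g k i : intertwines p q g ->
  (i <= k <= L)%N -> subprod q k i *m g i = g k *m subprod p k i.
Proof.
move=> pq /andP[ik kL]; elim: k ik kL => [|k IH] ik kL.
  by case: i ik => // _; rewrite !subprod_id mul1mx mulmx1.
move: ik; rewrite leq_eqVlt => /orP[/eqP ->|ik].
  by rewrite !subprod_id mul1mx mulmx1.
by rewrite !subprodS// -mulmxA IH ?(ltnW kL)// !mulmxA pq.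
Qed.

Definition same_ranks p q :=
  forall k i, (i <= k <= L)%N -> \rank (subprod p k i) = \rank (subprod q k i).

Lemma same_ranks_mult p q : same_ranks p q ->
  forall k i, (i <= k <= L)%N -> mult p k i = mult q k i.
Proof.
move=> pq k i /andP[ik kL]; rewrite /mult.
have rkE s t : (t <= s <= L.+1)%N -> rk p s t = rk q s t.
  move=> /andP[ts]; rewrite leq_eqVlt => /orP[/eqP sL|sL].
    subst s; move: ts; rewrite leq_eqVlt => /orP[/eqP->|tL]; first by rewrite !rk_diag.
    by rewrite !rk_top.
  by rewrite /rk pq// ts.
case: i ik => [|i] ik; rewrite /= !rkE//; lia.
Qed.

(** Basis vectors of the generator spaces are carried along their intervals. In layer [j] those
    whose interval contains [j] span and are [d j] in number, hence form a basis; matching these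
    bases of [p] and [q] defines [g j]. The layer maps send such a vector to the next one, or to 0
    at the end of its interval, so that the [g j] commute with them. *)
Lemma same_ranks_intertwined p q : same_ranks p q ->
  exists2 g, forall j, (j <= L)%N -> g j \in unitmx & intertwines p q g.
Proof.
move=> pq.
pose Ix := {z : 'I_L.+1 * 'I_L.+1 & 'I_(mult p z.1 z.2)}.
pose In j (x : Ix) := ((tag x).2 <= j <= (tag x).1)%N.
pose u (v : weights) j (x : Ix) : 'cV[R]_(d j) :=
  subprod v j (tag x).2 *m (vbasis (flow_gen v (tag x).1 (tag x).2))`_(tagged x).
have uS v j x : In j x -> u v j.+1 x = layer v j *m u v j x.
  by move=> /andP[xj _]; rewrite /u subprodS// mulmxA.
have u0 v (x : Ix) : ((tag x).2 <= (tag x).1)%N -> u v (tag x).1.+1 x = 0.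
  move=> ik; rewrite /u; set e := _`_ _.
  have : e \in flow_gen v (tag x).1 (tag x).2.
    (* The index is bounded by the multiplicity at [p], whereas [v] is arbitrary here; past the end
       of the basis the default value 0 is returned. *)
    rewrite /e; have [c|c] := ltnP (tagged x) (\dim (flow_gen v (tag x).1 (tag x).2)).
      by rewrite vbasis_mem// mem_nth// size_tuple.
    by rewrite nth_default ?mem0v// size_tuple.
  move: e => e eg; apply/eqP; rewrite -nullspaceE.
  have [Z _] := flow_genP v ik.
  have : e \in flowA v (tag x).1 (tag x).2 (tag x).2.
    by rewrite -Z (subvP (addvSl _ _)).
  by rewrite memv_cap => /andP[].
have uf v j : (j <= L)%N -> same_ranks p v ->
    (\sum_(x | In j x) <[u v j x]>)%VS = fullv.
  move=> jL pv; apply/eqP; rewrite eqEsubv subvf -(flow_gen_span v jL).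
  apply/subv_sumP => -[k i] /= ijk; apply/subvP => _ /mulmxvP[e eg ->].
  have dm : \dim (flow_gen v k i) = mult p k i.
    have ik : (i <= k)%N by lia.
    rewrite (same_ranks_mult pv) ?ik ?leq_ord//.
    by apply: dim_flow_a (flow_genP v ik); rewrite leqnn.
  rewrite (coord_vbasis eg) mulmx_sumr; apply: rpred_sum => c _.
  rewrite -scalemxAr memvZ//.
  have cm : (c < mult p k i)%N by rewrite -dm.
  pose x : Ix := existT (fun y : 'I_L.+1 * 'I_L.+1 => 'I_(mult p y.1 y.2)) (k, i)
    (Ordinal cm).
  by rewrite memvE; apply: (sumv_sup x).
have Icard j : (j <= L)%N -> #|In j| = d j.
  move=> jL; rewrite -(sum_mult p jL) -sum1_card.
  rewrite (eq_bigl (fun x : Ix => ((tag x).2 <= j <= (tag x).1)%N && true)); last first.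
    by move=> x; rewrite andbT.
  rewrite -(sig_big_dep (fun y : 'I_L.+1 * 'I_L.+1 => (y.2 <= j <= y.1)%N)
    (fun _ _ => true) (fun _ _ => 1%N)) /=.
  by apply: eq_bigr => y _; rewrite sum1_card card_ord.
have qq : same_ranks p p by [].
have gex j : exists g : 'M[R]_(d j), (j <= L)%N ->
    g \in unitmx /\ forall x, In j x -> g *m u p j x = u q j x.
  have [jL|Lj] := leqP j L; last by exists 0.
  have [g gU gu] := basis_change (Icard j jL) (uf p j jL qq) (uf q j jL pq).
  by exists g.
pose g j := projT1 (cid (gex j)).
have gP j : (j <= L)%N -> g j \in unitmx /\
    forall x, In j x -> g j *m u p j x = u q j x.
  exact: (projT2 (cid (gex j))).
exists g => [j /gP[]//|j jL].
have [[_ gj] [_ gj1]] := (gP j (ltnW jL), gP j.+1 jL).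
apply: (mulmx_span (uf p j (ltnW jL) qq)) => x xj.
rewrite -!mulmxA gj// -!uS//; have /andP[ij] := xj.
rewrite leq_eqVlt => /orP[/eqP jE|jk]; last by rewrite gj1// /In jk leqW.
have uj0 v : u v j.+1 x = 0 by subst j; apply: u0.
by rewrite !uj0 mulmx0.
Qed.

Definition gauge_conj (g h : forall j, 'M[R]_(d j)) (v : weights) : weights :=
  of_layers L (fun j => g j.+1 *m layer v j *m invmx (h j)).

Fact gauge_conj_is_linear g h : linear (gauge_conj g h).
Proof.
move=> x u v; apply: layer_inj => j jL; rewrite layerD layerZ !of_layersK//.
by rewrite layerD layerZ mulmxDr mulmxDl -scalemxAr -scalemxAl.
Qed.
HB.instance Definition _ g h :=
  GRing.isLinear.Build R weights weights *:%R (gauge_conj g h)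
    (gauge_conj_is_linear g h).

(** Isomorphisms [h] from [p'] to [p] and [g] from [q'] to [q] pull [c] back to g^-1 c h. The result
    still fixes [W] because [g] and [h] do, and [gauge_conj g h] maps its difference to that of [c].
    Used in both directions, this gives equality of dimensions along the stratum. *)
Lemma dim_tangentv_le W p q p' q' :
  same_ranks p' p -> same_ranks q' q ->
  subprod p L 0%N = W -> subprod q L 0%N = W ->
  subprod p' L 0%N = W -> subprod q' L 0%N = W ->
  (\dim (tangentv W p q) <= \dim (tangentv W p' q'))%N.
Proof.
move=> /same_ranks_intertwined[h hU pp] /same_ranks_intertwined[g gU qq] pW qW p'W q'W.
have sub : (tangentv W p q <= linfun (gauge_conj g h) @: tangentv W p' q')%VS.
  apply/subvP => _ /tangentvP[c + ->]; rewrite fixingE => /eqP cW.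
  pose c' := gpack (fun j => invmx (g j) *m gl j c *m h j).
  apply/memv_imgP; exists (gauge_diff p' q' c').
    apply/tangentvP; exists c' => //; rewrite fixingE !packK//.
    have hW : h L *m W = W *m h 0%N.
      by rewrite -{1}p'W -pW (intertwines_subprod pp)// leq0n leqnn.
    have gW : W *m g 0%N = g L *m W.
      by rewrite -{2}q'W -qW (intertwines_subprod qq)// leq0n leqnn.
    apply/eqP; rewrite -[LHS]mulmxA hW !mulmxA -(mulmxA (invmx (g L))) cW.
    congr (_ *m _); rewrite mulmxA; congr (_ *m _).
    rewrite -[in LHS](mulmxK (gU 0%N (leq0n L)) W) gW -mulmxA mulKmx ?gU//.
  rewrite lfunE; apply: layer_inj => j jL; rewrite !of_layersK// !packK//; last first.
    exact: ltnW.
  rewrite mulmxBr mulmxBl; congr (_ - _).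
    exact: (conjugate_right _ (gU j (ltnW jL)) (hU j (ltnW jL)) (qq j jL)).
  exact: (conjugate_left _ (gU j.+1 jL) (hU j (ltnW jL)) (pp j jL)).
rewrite (leq_trans (dimvS sub))//.
by rewrite -[X in (_ <= X)%N](limg_ker_dim (linfun (gauge_conj g h))) leq_addl.
Qed.

Definition gauge_act c p : weights := gauge_conj (gl^~ c) (gl^~ c) p.

Lemma gauge_act_stratum W r c p : stratum W r p -> c \in fixing W ->
  (forall j, (j <= L)%N -> gl j c \in unitmx) -> stratum W r (gauge_act c p).
Proof.
move=> [pW pr] + cU; rewrite fixingE => /eqP cW.
have pq : intertwines p (gauge_act c p) (gl^~ c).
  by move=> j jL; rewrite of_layersK// mulmxKV// cU// ltnW.
split.
  have := @intertwines_subprod _ _ _ L 0%N pq; rewrite leq0n leqnn => /(_ isT).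
  rewrite pW cW => /(congr1 (mulmx^~ (invmx (gl 0%N c)))).
  by rewrite !mulmxK// cU.
move=> k i ikL; rewrite -pr//; have := intertwines_subprod pq ikL.
have /andP[ik kL] := ikL.
move=> /(congr1 mxrank); rewrite mxrankMfree ?row_free_unit ?cU ?(leq_trans ik)// => ->.
by rewrite eqmxMfull // row_full_unit cU.
Qed.

Lemma gauge_diff_eq0 p q c :
  gauge_diff p q c = 0 <-> intertwines p q (gl^~ c).
Proof.
split=> [c0 j jL|pq].
  have := congr1 (fun v => layer v j) c0; rewrite of_layersK//.
  by rewrite layer0 => /eqP; rewrite subr_eq0 => /eqP.
apply: layer_inj => j jL; rewrite of_layersK// pq// subrr.
by rewrite layer0.
Qed.

End Gauge.

(** * The image of the infinitesimal action and its orthogonal complement *)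

Section TangentNormal.
Variables (R : realType) (L : nat) (d : nat -> nat).
Hypothesis L_ge1 : (1 <= L)%N.
Local Notation weights := 'rV[R]_(\sum_(j < L) d j.+1 * d j)%N.
Local Notation gauge := 'rV[R]_(\sum_(j < L.+1) d j * d j)%N.
Local Notation gl := (@unpack R L.+1 d d).
Local Notation gpack := (@pack R L.+1 d d).
Variable theta : weights.
Variables a b : forall k j i : nat, {vspace 'cV[R]_(d j)}.
Hypothesis flow_ab : flow_prebasis theta a b.
Local Notation sp := (subprod theta).
Local Notation lay := (layer theta).
Local Notation W := (subprod theta L 0%N).
Local Notation T := (tangentv W theta theta).

Lemma flow_a_null k j i : (i <= j <= k)%N -> (k <= L)%N ->
  (a k j i <= nullspace (sp k.+1 j))%VS.
Proof.
move=> ijk kL; have [aP _ _ _] := flow_ab; have [aE _] := aP _ _ _ ijk kL.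
exact: subv_trans (addvSl _ _) (subv_trans (eq_ind_r (fun X => X <= _)%VS (subvv _) aE) (capvSl _ _)).
Qed.

Lemma flow_b_null k j i : (i < j.+1)%N -> (j <= k <= L)%N -> (0 < i)%N ->
  (b k j i <= nullspace (sp j i.-1)^T)%VS.
Proof.
case: i => // i ij /andP[jk kL] _; have [_ bP _ _] := flow_ab.
have ijk : (i.+1 <= j <= k)%N by rewrite jk andbT.
have [bE _] := bP _ _ _ ijk kL.
exact: subv_trans (addvSl _ _) (subv_trans (eq_ind_r (fun X => X <= _)%VS (subvv _) bE) (capvSr _ _)).
Qed.

Definition at_gauge j (H : 'M[R]_(d j)) : gauge :=
  gpack (dfwith (fun s : nat => 0 : 'M[R]_(d s)) j H).

Lemma at_gauge_in j H : (j <= L)%N -> gl j (at_gauge H) = H.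
Proof. by move=> jL; rewrite packK// dfwithin. Qed.

Lemma at_gauge_out j s (H : 'M[R]_(d j)) : s != j -> gl s (at_gauge H) = 0.
Proof.
move=> sj; have [sL|Ls] := ltnP s L.+1; last exact: unpack_out.
by rewrite packK// dfwithout// eq_sym.
Qed.

(** A tau is an infinitesimal base change at the single layer [j.+1]. At [j.+1 = L] the first term
    of [tau_map] is out of range and vanishes, which matches the output layer. *)
Lemma gauge_diff_at_gauge j (H : 'M[R]_(d j.+1)) : (j < L)%N ->
  gauge_diff theta theta (at_gauge H) = tau_map theta H.
Proof.
move=> jL; apply: layer_inj => s sL; rewrite of_layersK// /tau_map layerB.
have [sj|sj] := eqVneq s j.
  subst s; rewrite at_gauge_out ?neq_ltn ?leqnn// mulmx0 at_gauge_in//.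
  by rewrite at_layer_out ?neq_ltn ?leqnn// at_layer_in.
rewrite [in X in _ = _ - X]at_layer_out// subr0.
rewrite (@at_gauge_out _ s.+1) ?eqSS// mul0mx subr0.
have [sj1|sj1] := eqVneq s j.+1.
  by subst s; rewrite at_gauge_in 1?ltnW// at_layer_in.
by rewrite at_gauge_out// at_layer_out// mulmx0.
Qed.

Lemma gauge_diff_at_gauge0 (H : 'M[R]_(d 0%N)) :
  gauge_diff theta theta (at_gauge H) = at_layer L (lay 0%N *m H).
Proof.
apply: layer_inj => s sL; rewrite of_layersK// (@at_gauge_out _ s.+1)// mul0mx subr0.
case: s sL => [|s] sL; first by rewrite at_gauge_in// at_layer_in.
by rewrite at_gauge_out// mulmx0 at_layer_out.
Qed.

Lemma tau_map_tangent j (H : 'M[R]_(d j.+1)) : (j.+1 < L)%N ->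
  tau_map theta H \in T.
Proof.
move=> jL; apply/tangentvP; exists (at_gauge H); last by rewrite gauge_diff_at_gauge// ltnW.
by rewrite fixingE !at_gauge_out ?mul0mx ?mulmx0// gtn_eqF.
Qed.

(** Modulo taus, the matrix is pushed upwards until layer [l], where the next weight matrix kills
    a_(l,l,i). At the output layer the base change must also fix [W]: since the block is not open,
    [0 < h], and then [H] annihilates W_(L~h-1). *)
Lemma phi_tangent_right l k j i h M : valid_block l k j i h -> (l <= k <= L)%N ->
  ~~ open_block L l k i h -> tensor (a l j.+1 i) (b k j h) M ->
  at_layer L M \in T.
Proof.
move=> v /andP[lk kL] no.
have [n] := ubnP (l - j); elim: n j M v => // n IH j M v ln Mab.
move: v; rewrite /valid_block => v.
have [|H Hab ME] := tensor_lift flow_ab _ kL Mab; first by lia.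
have -> : at_layer L M = at_layer L (lay j.+1 *m H) - tau_map theta H.
  by rewrite /tau_map opprB addrC subrK ME.
apply: memvB.
  have [jl|lj] := ltnP j.+1 l.
    apply: IH; rewrite /valid_block; [lia..|].
    by apply: tensor_succ => //; lia.
  have {}lj : l = j.+1 by lia.
  subst l; rewrite (tensor_null _ Hab) ?linear0 ?mem0v//.
  by rewrite -subprod1; apply: flow_a_null; lia.
have [jL|jL] := ltnP j.+1 L; first exact: tau_map_tangent.
have jE : L = j.+1 by lia.
have [lE kE] : l = L /\ k = L by lia.
have h0 : (0 < h)%N by move: no; rewrite /open_block; lia.
have jlt : (j < L)%N by lia.
apply/tangentvP; exists (at_gauge H); last by rewrite gauge_diff_at_gauge.
(* The layer is a variable [s] so that it can be identified with [L] inside the matrix types. *)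
have fix_top s (N : 'M[R]_(d s)) : s = L -> tensor (a l s i) (b k s h) N ->
    at_gauge N \in fixing W.
  move=> sL Nab; subst s; rewrite fixingE (@at_gauge_out _ 0%N) ?ltn_eqF// mulmx0.
  rewrite at_gauge_in// (@subprodM _ _ _ _ L h.-1 0%N); last by lia.
  rewrite mulmxA (tensor_nullr _ Nab) ?mul0mx//.
  by apply: flow_b_null; lia.
exact: fix_top Hab.
Qed.

(** The mirror image: the matrix is pushed downwards until layer [h], where b_(k,h,h) is killed. For
    [h = 0] the chain ends in a base change at the input layer, which fixes [W] because [l < L]
    makes W_(l+1~0) vanish on a_(l,0,0). *)
Lemma phi_tangent_left l k j i h M : valid_block l k j i h -> (l <= L)%N -> (k <= L)%N ->
  (i <= h)%N -> ~~ open_block L l k i h -> tensor (a l j.+1 i) (b k j h) M ->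
  at_layer L M \in T.
Proof.
move=> + lL kL ih no; elim: j M => [|j IH] M; rewrite /valid_block => v Mab.
  have [i0 h0] : i = 0%N /\ h = 0%N by lia.
  subst i h.
  have [|H Hab ->] := tensor_lower flow_ab _ lL Mab; first by lia.
  apply/tangentvP; exists (at_gauge H); last by rewrite gauge_diff_at_gauge0.
  have lL2 : (l < L)%N by move: no; rewrite /open_block; lia.
  rewrite fixingE at_gauge_out ?gtn_eqF// mul0mx at_gauge_in// eq_sym.
  rewrite (@subprodM _ _ _ _ L l.+1 0%N); last by lia.
  by rewrite -mulmxA (tensor_null _ Hab) ?mulmx0// flow_a_null.
have [|H Hab ->] := tensor_lower flow_ab _ lL Mab; first by lia.
have -> : at_layer L (lay j.+1 *m H) = tau_map theta H + at_layer L (H *m lay j).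
  by rewrite subrK.
apply: memvD; first by apply: tau_map_tangent; lia.
have [hj|jh] := ltnP h j.+1.
  apply: IH; first by rewrite /valid_block; lia.
  by apply: tensor_pred => //; lia.
have {}jh : h = j.+1 by lia.
subst h; rewrite (tensor_nullr _ Hab) ?linear0 ?mem0v//.
by rewrite -subprod1; apply: flow_b_null; lia.
Qed.

Lemma theta_span_tangent : (theta_span theta a b <= T)%VS.
Proof.
apply/subv_sumP => x /andP[vx nx]; rewrite /tangent_family vx; move: vx nx; rewrite /valid_index /last_in_block.
move: (leq_ord x.2.1.1) (leq_ord x.2.2.1) (ltn_ord x.1).
case: x => -[j jL] [[[l ?] [i ?]] [[k ?] [h ?]]] /= {jL} lL kL jL.
rewrite /tangent_member => v nlast; apply/subvP => u; case: ifP => jo; last first.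
  have no : ~~ open_block L l k i h.
    by move: v jo nlast; rewrite /valid_block; case: open_block => //=; lia.
  case/memv_imgP => M /tensvP Mab ->; rewrite lfunE.
  have [lk|kl] := leqP l k; first by apply: phi_tangent_right Mab => //; rewrite lk.
  have ih : (i <= h)%N by move: no; rewrite /open_block; lia.
  exact: phi_tangent_left Mab.
by case/memv_imgP => H _ ->; rewrite lfunE; apply: tau_map_tangent; lia.
Qed.

(** Each layer contributes [y j - y j.+1], and the sum telescopes to its two ends. The upper end
    vanishes if [k < L], as W_(k+1~h) kills a_(k,h,h), and the lower one if [0 < i], as the
    transpose of W_(l~i-1) kills b_(l,l,i). In the remaining cases [l = L] and [h = 0], and [c]
    fixing [W] relates the ends. *)
Lemma psi_orthogonal l k i h (M : 'M[R]_(d l, d h)) c :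
  (l <= L)%N -> (k <= L)%N -> (i <= k.+1)%N -> (h <= k)%N -> (i <= l)%N ->
  open_block L l k i h -> tensor (b l l i) (a k h h) M ->
  c \in fixing W -> dotmul (psi_map theta k i M) (gauge_diff theta theta c) = 0.
Proof.
move=> lL kL ik hk il o Mab; rewrite fixingE => /eqP cW.
pose y j := \tr (sp j h *m M^T *m sp l j *m gl j c).
rewrite (@dotmul_unpack R L (fun j => d j.+1) d).
(* The range [i <= j.+1 <= k.+1], cut off at the number of layers, is the half-open range from
   [i.-1] to [m]. *)
pose m := minn k.+1 L.
have im : (i.-1 <= m)%N by rewrite /m; lia.
transitivity (y i.-1 - y m).
  transitivity (\sum_(j < L) if (i.-1 <= j < m)%N then y j - y j.+1 else 0).
    apply: eq_bigr => j _; have jL := ltn_ord j.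
    rewrite -!layerE !of_layersK// /psi_layers.
    have -> : (i.-1 <= j < m)%N = (i <= j.+1 <= k.+1)%N by rewrite /m; lia.
    case: ifP => ijk; last by rewrite trmx0 mul0mx mxtrace0.
    have [jl hj] : (j < l)%N /\ (h <= j)%N by move: o; rewrite /open_block; lia.
    rewrite !trmx_mul !trmxK mulmxBr raddfB /=; congr (_ - _).
      by rewrite /y (subprodSr _ jl) !mulmxA.
    by rewrite mxtrace_mulC -mulmxA mxtrace_mulC /y subprodS// !mulmxA.
  rewrite -(big_mkord xpredT (fun j => if (i.-1 <= j < m)%N then y j - y j.+1 else 0)) /=.
  rewrite -big_mkcond /= (eq_bigl (fun j => (j < m) && (i.-1 <= j))%N); last first.
    by move=> j; rewrite andbC.
  rewrite -(big_nat_widenl i.-1 0%N _ (fun j => j < m)%N)//.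
  rewrite -(big_nat_widen _ _ _ xpredT) ?geq_minr//.
  rewrite (telescope_sumr_eq (fun j => - y j))//; first by rewrite opprK addrC.
  by move=> j _; rewrite opprK addrC.
have yk : (k < L)%N -> y m = 0.
  move=> kL2; have -> : m = k.+1 by rewrite /m; lia.
  have /tensor_trP Mt := Mab.
  rewrite /y (tensor_null _ Mt) ?mul0mx ?mxtrace0//; apply: flow_a_null; lia.
have yi : (0 < i)%N -> y i.-1 = 0.
  move=> i0; have /tensor_trP Mt := Mab.
  rewrite /y -mulmxA -(mulmxA (sp _ _)) (mulmxA M^T) (tensor_nullr _ Mt) ?mul0mx ?mulmx0 ?mxtrace0//.
  by apply: flow_b_null; lia.
have [/andP[kL2 i0]|nki] := boolP ((k < L) && (0 < i))%N.
  by rewrite yk// yi// subrr.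
have [lE hE] : l = L /\ h = 0%N by move: o; rewrite /open_block; lia.
subst l h.
(* The boundary term at the output layer; through [zE] it can also be read at the input layer. *)
pose z := \tr (W *m M^T *m gl L c).
have zE : z = \tr (M^T *m W *m gl 0%N c).
  by rewrite /z -mulmxA mxtrace_mulC -!mulmxA cW.
have [kL2|Lk] := ltnP k L.
  have i0 : i = 0%N by lia.
  subst i; rewrite yk// subr0 /y subprod_id mul1mx -zE /z.
  have /tensor_trP Mt := Mab.
  rewrite (@subprodM _ _ _ _ L k.+1 0%N)// -(mulmxA _ _ M^T) (tensor_null _ Mt).
    by rewrite mulmx0 mul0mx mxtrace0.
  by apply: flow_a_null; lia.
have kE : k = L by lia.
have -> : m = L by rewrite /m; lia.
have -> : y L = z by rewrite /y subprod_id mulmx1.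
have [i0|] := posnP i; first by subst i; rewrite /y subprod_id mul1mx -zE subrr.
move=> i0; rewrite yi// sub0r zE (@subprodM _ _ _ _ L i.-1 0%N); last by lia.
have /tensor_trP Mt := Mab.
rewrite (mulmxA M^T) (tensor_nullr _ Mt) ?mul0mx ?mxtrace0 ?oppr0//.
by apply: flow_b_null; lia.
Qed.

Lemma tangent_psi_orthogonal u v : u \in T -> v \in psi_span theta a b -> dotmul u v = 0.
Proof.
case/tangentvP => c cW -> /memv_sumP[w wG ->].
rewrite dotmulC.
have -> : dotmul (\sum_(x | valid_index x && last_in_block x) w x) (gauge_diff theta theta c) =
    \sum_(x | valid_index x && last_in_block x) dotmul (w x) (gauge_diff theta theta c).
  by apply: (big_morph (fun v => dotmul v _)) => [x y|]; rewrite ?dotmulDl// dotmulC dotmul0r.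
rewrite big1// => x /andP[vx lx]; have := wG x; rewrite vx lx => /(_ isT).
rewrite /normal_family vx /normal_member; move: vx lx; rewrite /valid_index /last_in_block /valid_block.
move: (leq_ord x.2.1.1) (leq_ord x.2.2.1).
case: x => j [[[l ?] [i ?]] [[k ?] [h ?]]] /= lL kL vx lx.
rewrite lx => /memv_imgP[M /tensvP Mab ->]; rewrite lfunE.
have /andP[ob _] := lx.
by apply: psi_orthogonal ob Mab cW; lia.
Qed.

Lemma tangent_normal :
  [/\ T = theta_span theta a b,
      forall v, (forall u, u \in T -> dotmul u v = 0) -> v \in psi_span theta a b
    & forall u, (forall v, v \in psi_span theta a b -> dotmul u v = 0) -> u \in T].
Proof.
apply: orthogonal_complement; first exact: theta_span_tangent.
- exact: tangent_psi_orthogonal.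
- exact: dim_theta_psi_span.
Qed.

End TangentNormal.

(** * Rational functions and their smoothness *)

Section RationalFunctions.
Variables (R : realType) (V : normedModType R).
Implicit Types (U : set V) (f g : V -> R).

Lemma near_eq_differentiable (W : normedModType R) (f g : V -> W) x :
  (\forall y \near x, f y = g y) -> differentiable f x -> differentiable g x.
Proof.
move=> fg df; have [dfc fE] := (diff_locallyP x f).1 df.
have gE : g \o shift x = cst (g x) + 'd f x +o_ 0 id.
  apply/eqaddoP => e e0; have /eqaddoP/(_ e e0) := fE.
  have fg0 : \forall h \near (0 : V), f (h + x) = g (h + x).
    by move: fg; rewrite (near_shift 0 x) /=; apply: filterS => h; rewrite subr0.
  move: fg0; apply: filterS2 => h fgh; by rewrite !fctE /= -fgh -(nbhs_singleton fg).
have dgE := diff_unique dfc gE.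
by apply/diff_locallyP; rewrite dgE.
Qed.

(** An inductive class, so that closure under directional derivatives is proved by induction on the
    construction. Affine functions enter through their constant directional derivatives. [Rat_ext]
    compares functions on [U] alone, as the quotient rule holds only where the denominator does not
    vanish. *)
Inductive rational_on U : (V -> R) -> Prop :=
| Rat_affine f of (forall x, differentiable f x)
    & (forall v, exists c, forall x, 'D_v f x = c) : rational_on U f
| Rat_add f g of rational_on U f & rational_on U g :
    rational_on U (fun x => f x + g x)
| Rat_mul f g of rational_on U f & rational_on U g :
    rational_on U (fun x => f x * g x)
| Rat_inv f of rational_on U f & (forall x, U x -> f x != 0) :
    rational_on U (fun x => (f x)^-1)
| Rat_ext f g of rational_on U f & (forall x, U x -> f x = g x) :
    rational_on U g.

Lemma rational_sub U1 U2 f : U1 `<=` U2 -> rational_on U2 f -> rational_on U1 f.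
Proof.
move=> U12; elim=> {f} [f df dc|f g _ IHf _ IHg|f g _ IHf _ IHg|f _ IHf f0|f g _ IHf fg].
- exact: Rat_affine.
- exact: Rat_add.
- exact: Rat_mul.
- by apply: Rat_inv => // x /U12/f0.
- by apply: (Rat_ext IHf) => x /U12/fg.
Qed.

Lemma rational_cst U c : rational_on U (fun=> c).
Proof.
apply: Rat_affine => [x|v]; first exact: differentiable_cst.
by exists 0 => x; exact: derive_cst.
Qed.

Lemma rational_opp U f : rational_on U f -> rational_on U (fun x => - f x).
Proof.
move=> /(Rat_mul (rational_cst U (-1))) h.
by apply: (Rat_ext h) => x _; rewrite mulN1r.
Qed.

Lemma rational_sum U (I : Type) (s : seq I) (P : pred I) (F : I -> V -> R) :
  (forall i, rational_on U (F i)) -> rational_on U (fun x => \sum_(i <- s | P i) F i x).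
Proof.
move=> FU; elim: s => [|i s IH].
  by apply: (Rat_ext (rational_cst U 0)) => x _; rewrite big_nil.
case: (boolP (P i)) => Pi.
  by apply: (Rat_ext (Rat_add (FU i) IH)) => x _; rewrite big_cons Pi.
by apply: (Rat_ext IH) => x _; rewrite big_cons (negbTE Pi).
Qed.

Lemma rational_prod U (I : Type) (s : seq I) (P : pred I) (F : I -> V -> R) :
  (forall i, rational_on U (F i)) -> rational_on U (fun x => \prod_(i <- s | P i) F i x).
Proof.
move=> FU; elim: s => [|i s IH].
  by apply: (Rat_ext (rational_cst U 1)) => x _; rewrite big_nil.
case: (boolP (P i)) => Pi.
  by apply: (Rat_ext (Rat_mul (FU i) IH)) => x _; rewrite big_cons Pi.
by apply: (Rat_ext IH) => x _; rewrite big_cons (negbTE Pi).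
Qed.

Lemma rational_differentiable U f x : open U -> rational_on U f -> U x ->
  differentiable f x.
Proof.
move=> oU rf Ux; elim: rf => {f} [f df _|f g _ df _ dg|f g _ df _ dg|f _ df f0|f g _ df fg].
- exact: df.
- exact: differentiableD.
- exact: differentiableM.
- by apply: differentiableV => //; exact: f0.
- by apply: (near_eq_differentiable _ df); exact: (filterS fg (open_nbhs_nbhs (conj oU Ux))).
Qed.

(** The usual rules of differentiation. Openness of [U] serves the case [Rat_ext]: functions that
    agree on [U] agree near each of its points, hence have the same derivatives there. *)
Lemma rational_derive U f v : open U -> rational_on U f ->
  rational_on U ('D_v f).
Proof.
move=> oU; have der h x : rational_on U h -> U x -> derivable h x v.
  by move=> rh Ux; apply: diff_derivable; exact: rational_differentiable Ux.
elim=> {f} [f _ dc|f g rf rdf rg rdg|f g rf rdf rg rdg|f rf rdf f0|f g rf rdf fg].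
- have [c cE] := dc v; by apply: (Rat_ext (rational_cst U c)) => x _; rewrite cE.
- apply: (Rat_ext (Rat_add rdf rdg)) => x Ux.
  by rewrite -deriveD//; exact: der.
- apply: (Rat_ext (Rat_add (Rat_mul rf rdg) (Rat_mul rg rdf))) => x Ux.
  by rewrite [RHS]deriveM//; exact: der.
- have rV := Rat_inv rf f0.
  apply: (Rat_ext (rational_opp (Rat_mul (Rat_mul rV rV) rdf))) => x Ux.
  rewrite [RHS]deriveV ?f0//; last exact: der.
  by rewrite -scaleNr expr2 invfM.
- apply: (Rat_ext rdf) => x Ux; apply: near_eq_derive.
  exact: (filterS fg (open_nbhs_nbhs (conj oU Ux))).
Qed.

Lemma rational_mx_differentiable n U (f : V -> 'rV[R]_n) x : open U ->
  (forall i, rational_on U (fun x => f x 0 i)) -> U x -> differentiable f x.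
Proof.
move=> oU rf Ux.
have -> : f = \sum_(i < n) (fun x => f x 0 i *: delta_mx 0 i).
  apply/funext => y; rewrite {1}(row_sum_delta (f y)) fct_sumE; exact: eq_bigr.
apply: differentiable_sum => i; apply: differentiableZl.
exact: rational_differentiable (rf i) Ux.
Qed.

Lemma rational_smooth n U (f : V -> 'rV[R]_n) : open U ->
  (forall i, rational_on U (fun x => f x 0 i)) -> smooth_on U f.
Proof.
move=> oU + k; elim: k f => [|k IH] f rf.
  move=> x Ux; apply: differentiable_continuous.
  exact: rational_mx_differentiable Ux.
split=> [x Ux|v]; first exact: rational_mx_differentiable Ux.
apply: IH => i; apply: (Rat_ext (rational_derive v oU (rf i))) => x Ux.
rewrite derive_mx ?mxE//; apply: diff_derivable.
exact: rational_mx_differentiable Ux.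
Qed.

End RationalFunctions.

Section RationalMatrices.
Variables (R : realType) (V : normedModType R).
Implicit Types (U : set V).

Definition mx_rational m n U (F : V -> 'M[R]_(m, n)) :=
  forall i j, rational_on U (fun x => F x i j).

Lemma mx_rational_sub m n U1 U2 (F : V -> 'M[R]_(m, n)) :
  U1 `<=` U2 -> mx_rational U2 F -> mx_rational U1 F.
Proof. by move=> U12 rF i j; apply: rational_sub (rF i j). Qed.

Lemma mx_rational_cst m n U (A : 'M[R]_(m, n)) : mx_rational U (fun=> A).
Proof. by move=> i j; exact: rational_cst. Qed.

Lemma mx_rationalD m n U (F G : V -> 'M[R]_(m, n)) :
  mx_rational U F -> mx_rational U G -> mx_rational U (fun x => F x + G x).
Proof.
by move=> rF rG i j; apply: (Rat_ext (Rat_add (rF i j) (rG i j))) => x _; rewrite mxE.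
Qed.

Lemma mx_rationalN m n U (F : V -> 'M[R]_(m, n)) :
  mx_rational U F -> mx_rational U (fun x => - F x).
Proof.
by move=> rF i j; apply: (Rat_ext (rational_opp (rF i j))) => x _; rewrite mxE.
Qed.

Lemma mx_rationalM m n p U (F : V -> 'M[R]_(m, n)) (G : V -> 'M[R]_(n, p)) :
  mx_rational U F -> mx_rational U G -> mx_rational U (fun x => F x *m G x).
Proof.
move=> rF rG i j.
apply: (Rat_ext (f := fun x => \sum_k F x i k * G x k j)) => [|x _]; last by rewrite mxE.
by apply: rational_sum => k; exact: Rat_mul.
Qed.

Lemma rational_det n U (F : V -> 'M[R]_n) :
  mx_rational U F -> rational_on U (fun x => \det (F x)).
Proof.
move=> rF; apply: rational_sum => s; apply: Rat_mul; first exact: rational_cst.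
by apply: rational_prod => i.
Qed.

Lemma mx_rationalV n U (F : V -> 'M[R]_n) :
  mx_rational U F -> (forall x, U x -> F x \in unitmx) ->
  mx_rational U (fun x => invmx (F x)).
Proof.
move=> rF uF i j.
(* Cramer's rule: an entry of the inverse is a cofactor divided by the determinant. *)
apply: (Rat_ext (f := fun x => (\det (F x))^-1 *
    ((-1) ^+ (j + i) * \det (row' j (col' i (F x)))))) => [|x Ux]; last first.
  by rewrite /invmx uF// !mxE.
apply: Rat_mul.
  apply: Rat_inv; first exact: rational_det.
  by move=> x /uF; rewrite unitmxE unitfE.
apply: Rat_mul; first exact: rational_cst.
apply: rational_det => s t.
by apply: (Rat_ext (rF (lift j s) (lift i t))) => x _; rewrite !mxE.
Qed.

Lemma mx_rational_pack n e f U (X : V -> forall j, 'M[R]_(e j, f j)) :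
  (forall j, (j < n)%N -> mx_rational U (X^~ j)) ->
  mx_rational U (fun x => @pack R n e f (X x)).
Proof.
move=> rX i s; have [j [k [l E]]] := pack_entry R s.
by apply: (Rat_ext (rX j (ltn_ord j) k l)) => x _; rewrite ord1 E.
Qed.

Lemma mx_rational_unpack n e f U F j :
  mx_rational U F -> mx_rational U (fun x => @unpack R n e f j (F x)).
Proof.
move=> rF i i'; have [jn|nj] := ltnP j n.
  have [s E] := unpack_entry R i i' jn.
  by apply: (Rat_ext (rF 0 s)) => x _; rewrite E.
by apply: (Rat_ext (rational_cst U 0)) => x _; rewrite unpack_out// mxE.
Qed.

Lemma rational_linear m n U (phi : {scalar 'M[R]_(m, n)}) (F : V -> 'M[R]_(m, n)) :
  mx_rational U F -> rational_on U (fun x => phi (F x)).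
Proof.
move=> rF.
apply: (Rat_ext (f := fun x => \sum_i \sum_j F x i j * phi (delta_mx i j))); last first.
  move=> x _; rewrite [in RHS](matrix_sum_delta (F x)) raddf_sum; apply: eq_bigr => i _.
  rewrite raddf_sum; apply: eq_bigr => j _; exact: (esym (scalarZ phi (F x i j) (delta_mx i j))).
apply: rational_sum => i; apply: rational_sum => j.
by apply: Rat_mul => //; exact: rational_cst.
Qed.

Lemma open_rational U (f : V -> R) : open U -> rational_on U f ->
  open (U `&` [set x | f x != 0]).
Proof.
move=> oU rf; rewrite openE => x [Ux fx0]; rewrite /interior.
apply: filterI; first exact: open_nbhs_nbhs.
have /differentiable_continuous fc := rational_differentiable oU rf Ux.
have : nbhs (f x) [set y | y != 0].
  by apply: open_nbhs_nbhs; split => //; exact: open_neq.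
by move/fc.
Qed.

Lemma mx_rational_continuous n U (F : V -> 'rV[R]_n) x :
  open U -> mx_rational U F -> U x -> {for x, continuous F}.
Proof.
move=> oU rF Ux; apply: differentiable_continuous.
exact: rational_mx_differentiable oU (rF 0) Ux.
Qed.

End RationalMatrices.

Lemma mx_rational_id (R : realType) n (U : set 'rV[R]_n) : mx_rational U (fun x => x).
Proof.
move=> i j; apply: Rat_affine => [x|v]; first exact: differentiable_coord.
exists (v i j) => x.
have /derive_mx : derivable (id : 'rV[R]_n -> 'rV[R]_n) x v by exact: derivable_id.
rewrite derive_id => /matrixP/(_ i j).
by rewrite mxE => ->.
Qed.

Lemma rational_id (R : realType) (U : set R) : rational_on U (fun x => x).
Proof.
apply: Rat_affine => [x|v]; first exact: ex_diff.
by exists v => x; exact: derive_id.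
Qed.

(** * Rational charts of the stratum *)

Section Chart.
Variables (R : realType) (L : nat) (d : nat -> nat).
Local Notation weights := 'rV[R]_(\sum_(j < L) d j.+1 * d j)%N.
Local Notation gauge := 'rV[R]_(\sum_(j < L.+1) d j * d j)%N.
Local Notation gl := (@unpack R L.+1 d d).
Local Notation gpack := (@pack R L.+1 d d).
Variables (W : 'M[R]_(d L, d 0%N)) (r : nat -> nat -> nat) (p : weights).
Hypothesis pS : stratum W r p.

Lemma stratum_same_ranks q q' : stratum W r q -> stratum W r q' -> same_ranks q q'.
Proof. by move=> [_ qr] [_ q'r] k i ik; rewrite qr// q'r. Qed.

Lemma dim_tangentv_stratum q q1 q' q1' :
  stratum W r q -> stratum W r q1 -> stratum W r q' -> stratum W r q1' ->
  \dim (tangentv W q q1) = \dim (tangentv W q' q1').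
Proof.
move=> S1 S2 S3 S4; apply/eqP; rewrite eqn_leq.
have [[W1 _] [W2 _] [W3 _] [W4 _]] := And4 S1 S2 S3 S4.
by rewrite !dim_tangentv_le//; apply: stratum_same_ranks.
Qed.

Definition gauge1 : gauge := gpack (fun j => 1%:M).

Lemma gauge1E j : (j <= L)%N -> gl j gauge1 = 1%:M.
Proof. by move=> jL; rewrite packK. Qed.

Lemma gauge1_fixing : gauge1 \in fixing W.
Proof. by rewrite fixingE !gauge1E// mul1mx mulmx1. Qed.

Lemma gauge_act1 : gauge_act gauge1 p = p.
Proof.
apply: layer_inj => j jL; rewrite of_layersK// !gauge1E//; last exact: ltnW.
by rewrite mul1mx invmx1 mulmx1.
Qed.

Lemma gauge_diff_act c : (forall j, (j <= L)%N -> gl j c \in unitmx) ->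
  gauge_diff p (gauge_act c p) c = 0.
Proof.
by move=> cU; apply/gauge_diff_eq0 => j jL; rewrite of_layersK// mulmxKV// cU// ltnW.
Qed.

Lemma gauge_diff_eq0_act q c : (forall j, (j <= L)%N -> gl j c \in unitmx) ->
  gauge_diff p q c = 0 -> q = gauge_act c p.
Proof.
move=> cU /gauge_diff_eq0 pq; apply: layer_inj => j jL.
by rewrite of_layersK// -pq// mulmxK// cU// ltnW.
Qed.

Definition gauge_det c := \prod_(j < L.+1) \det (gl j c).

Lemma gauge_detP c :
  reflect (forall j, (j <= L)%N -> gl j c \in unitmx) (gauge_det c != 0).
Proof.
apply: (iffP (prodf_neq0 _ _)) => [h j jL|h [j jL] _].
  by have := h (Ordinal (jL : (j < L.+1)%N)) isT; rewrite unitmxE unitfE.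
by have := h j jL; rewrite unitmxE unitfE.
Qed.

Lemma gauge_det1 : gauge_det gauge1 != 0.
Proof. by apply/gauge_detP => j jL; rewrite gauge1E// unitmx1. Qed.

Lemma rational_gauge_det (V : normedModType R) U (c : V -> gauge) :
  mx_rational U c -> rational_on U (fun x => gauge_det (c x)).
Proof.
move=> rc; apply: rational_prod => j; apply: rational_det.
exact: mx_rational_unpack.
Qed.

Lemma mx_rational_layer (V : normedModType R) U (q : V -> weights) j :
  mx_rational U q -> mx_rational U (fun x => layer (q x) j).
Proof. exact: (@mx_rational_unpack _ _ _ (fun j => d j.+1) d). Qed.

Lemma mx_rational_gauge_act (V : normedModType R) U (c : V -> gauge) :
  mx_rational U c -> (forall x, U x -> gauge_det (c x) != 0) ->
  mx_rational U (fun x => gauge_act (c x) p).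
Proof.
move=> rc cU; apply: (@mx_rational_pack _ _ _ (fun j => d j.+1) d _
  (fun x j => gl j.+1 (c x) *m layer p j *m invmx (gl j (c x)))) => j jL.
apply: mx_rationalM; last first.
  apply: mx_rationalV; first exact: mx_rational_unpack.
  by move=> x /cU/gauge_detP; apply; exact: ltnW.
apply: mx_rationalM; first exact: mx_rational_unpack.
exact: mx_rational_cst.
Qed.

Lemma mx_rational_gauge_diff (V : normedModType R) U (q : V -> weights) (c : V -> gauge) :
  mx_rational U q -> mx_rational U c -> mx_rational U (fun x => gauge_diff p (q x) (c x)).
Proof.
move=> rq rc; apply: (@mx_rational_pack _ _ _ (fun j => d j.+1) d _
  (fun x j => layer (q x) j *m gl j (c x) - gl j.+1 (c x) *m layer p j)) => j jL.
apply: mx_rationalD; last apply: mx_rationalN; apply: mx_rationalM.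
- exact: mx_rational_layer.
- exact: mx_rational_unpack.
- exact: mx_rational_unpack.
- exact: mx_rational_cst.
Qed.

Local Notation T := (tangentv W p p).
Local Notation m := (\dim T).
Local Notation B := (vbasis T).
(** The rows lift a basis of T to base changes fixing [W]. Thus [1 + x K] is an affine slice through
    the identity, transversal to the stabilizer of [p]. *)
Variable K : 'M[R]_(m, \sum_(j < L.+1) d j * d j).
Hypothesis K_fixing : forall s, row s K \in fixing W.
Hypothesis K_basis : forall s, gauge_diff p p (row s K) = B`_s.

Definition par (x : 'rV[R]_m) : gauge := gauge1 + x *m K.
(** [coord] is linear on the whole weight space, so this also applies to [gauge_diff p q c] with
    [q != p], which may leave T. *)
Definition coords (v : weights) : 'rV[R]_m := \row_t coord B t v.

Fact coords_is_linear : linear coords.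
Proof. by move=> a u v; apply/rowP => t; rewrite !mxE linearP. Qed.
HB.instance Definition _ :=
  GRing.isLinear.Build R weights 'rV[R]_m *:%R coords coords_is_linear.

Definition jac (q : weights) : 'M[R]_m := \matrix_s coords (gauge_diff p q (row s K)).
(** The solution [x] of [coords (gauge_diff p q (par x)) = 0], an affine equation in [x] with linear
    part [jac q]. *)
Definition chart (q : weights) : 'rV[R]_m :=
  - coords (gauge_diff p q gauge1) *m invmx (jac q).
Definition param (x : 'rV[R]_m) : weights := gauge_act (par x) p.

Lemma mulK_fixing x : x *m K \in fixing W.
Proof.
by rewrite mulmx_sum_row; apply: rpred_sum => s _; rewrite memvZ.
Qed.

Lemma par_fixing x : par x \in fixing W.
Proof. by rewrite memvD// ?gauge1_fixing// mulK_fixing. Qed.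

Lemma coords_gauge_diff q x :
  coords (gauge_diff p q (par x)) = coords (gauge_diff p q gauge1) + x *m jac q.
Proof.
rewrite /par !linearD /=; congr (_ + _).
rewrite mulmx_sum_row !linear_sum /= mulmx_sum_row; apply: eq_bigr => s _.
by rewrite !linearZ /= rowK.
Qed.

Lemma chart_unique q x : jac q \in unitmx -> gauge_diff p q (par x) = 0 -> chart q = x.
Proof.
move=> qU /(congr1 coords); rewrite coords_gauge_diff linear0 => /eqP.
rewrite addrC addr_eq0 => /eqP xE.
by rewrite /chart -xE mulmxK.
Qed.

(** By construction the coordinates along T vanish. They suffice, because [coords] maps
    [tangentv W p q] onto a space of dimension [m], which is also the dimension of [tangentv W p q]
    when [q] is in the stratum; so [coords] is injective there. *)
Lemma gauge_diff_chart q : stratum W r q -> jac q \in unitmx ->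
  gauge_diff p q (par (chart q)) = 0.
Proof.
move=> qS qU.
have qT : gauge_diff p q (par (chart q)) \in tangentv W p q.
  by apply/tangentvP; exists (par (chart q)); rewrite ?par_fixing.
have q0 : coords (gauge_diff p q (par (chart q))) = 0.
  by rewrite coords_gauge_diff /chart mulmxKV// addrN.
have full : (linfun coords @: tangentv W p q)%VS = fullv.
  apply/eqP; rewrite eqEsubv subvf /=; apply/subvP => y _.
  apply/memv_imgP; exists (gauge_diff p q (y *m invmx (jac q) *m K)).
    by apply/tangentvP; exists (y *m invmx (jac q) *m K); rewrite ?mulK_fixing.
  have := coords_gauge_diff q (y *m invmx (jac q)).
  rewrite /par !linearD /= => /addrI E.
  by rewrite lfunE /= E mulmxKV.
have := limg_ker_dim (linfun coords) (tangentv W p q).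
rewrite full (dim_tangentv_stratum pS qS pS pS) dimvf /dim /= mul1n.
move=> /eqP; rewrite -[X in _ == X]add0n eqn_add2r dimv_eq0 => /eqP ker0.
apply/eqP; rewrite -memv0 -ker0 memv_cap qT memv_ker lfunE.
by apply/eqP.
Qed.

Lemma jac_p : jac p = 1%:M.
Proof.
apply/row_matrixP => s; rewrite rowK K_basis row1; apply/rowP => t.
rewrite [LHS]mxE coord_free ?(basis_free (vbasisP T))// [RHS]mxE eqxx eq_sym.
by [].
Qed.

Lemma gauge_diff_p_gauge1 : gauge_diff p p gauge1 = 0.
Proof.
by apply/gauge_diff_eq0 => j jL; rewrite !gauge1E// ?mulmx1 ?mul1mx//; exact: ltnW.
Qed.

Lemma chart_p : chart p = 0.
Proof. by rewrite /chart gauge_diff_p_gauge1 linear0 oppr0 mul0mx. Qed.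

Lemma mx_rational_par (V : normedModType R) U (x : V -> 'rV[R]_m) :
  mx_rational U x -> mx_rational U (fun y => par (x y)).
Proof.
move=> rx; apply: mx_rationalD; first exact: mx_rational_cst.
by apply: mx_rationalM => //; exact: mx_rational_cst.
Qed.

Lemma mx_rational_coords (V : normedModType R) U (v : V -> weights) :
  mx_rational U v -> mx_rational U (fun y => coords (v y)).
Proof.
move=> rv i t; apply: (Rat_ext (rational_linear (coord B t) rv)) => y _.
by rewrite mxE.
Qed.

Lemma mx_rational_jac (V : normedModType R) U (q : V -> weights) :
  mx_rational U q -> mx_rational U (fun y => jac (q y)).
Proof.
move=> rq s t.
have rs := mx_rational_coords (mx_rational_gauge_diff rq (mx_rational_cst U (row s K))).
by apply: (Rat_ext (rs 0 t)) => y _; rewrite [in RHS]mxE.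
Qed.

Lemma mx_rational_chart (V : normedModType R) U (q : V -> weights) :
  mx_rational U q -> (forall y, U y -> jac (q y) \in unitmx) ->
  mx_rational U (fun y => chart (q y)).
Proof.
move=> rq qU; apply: mx_rationalM; last first.
  by apply: mx_rationalV => //; exact: mx_rational_jac.
apply: mx_rationalN; apply: mx_rational_coords.
by apply: mx_rational_gauge_diff => //; exact: mx_rational_cst.
Qed.

Definition chart_dom0 : set weights := [set q | \det (jac q) != 0].
(** Where [jac q] is invertible, [chart q] solves the equation on the stratum; that [par (chart q)]
    is invertible makes the solution a group element carrying [p] to [q]. *)
Definition chart_dom : set weights :=
  chart_dom0 `&` [set q | gauge_det (par (chart q)) != 0].
Definition param_dom0 : set 'rV[R]_m := [set x | gauge_det (par x) != 0].
Definition param_dom : set 'rV[R]_m :=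
  param_dom0 `&` [set x | \det (jac (param x)) != 0].

Lemma chart_dom0_unit q : chart_dom0 q -> jac q \in unitmx.
Proof. by rewrite unitmxE unitfE. Qed.

Lemma open_chart_dom0 : open chart_dom0.
Proof.
rewrite -[chart_dom0]setTI; apply: open_rational; first exact: openT.
by apply: rational_det; apply: mx_rational_jac; exact: mx_rational_id.
Qed.

Lemma rational_chart : mx_rational chart_dom0 chart.
Proof.
apply: mx_rational_chart; first exact: mx_rational_id.
exact: chart_dom0_unit.
Qed.

Lemma open_chart_dom : open chart_dom.
Proof.
apply: open_rational; first exact: open_chart_dom0.
by apply: rational_gauge_det; apply: mx_rational_par; exact: rational_chart.
Qed.

Lemma open_param_dom0 : open param_dom0.
Proof.
rewrite -[param_dom0]setTI; apply: open_rational; first exact: openT.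
by apply: rational_gauge_det; apply: mx_rational_par; exact: mx_rational_id.
Qed.

Lemma rational_param : mx_rational param_dom0 param.
Proof.
by apply: mx_rational_gauge_act => //; apply: mx_rational_par; exact: mx_rational_id.
Qed.

Lemma open_param_dom : open param_dom.
Proof.
apply: open_rational; first exact: open_param_dom0.
by apply: rational_det; apply: mx_rational_jac; exact: rational_param.
Qed.

Lemma chart_dom_p : chart_dom p.
Proof.
split; rewrite /chart_dom0 /= ?jac_p ?det1 ?oner_eq0//.
by rewrite chart_p /par mul0mx addr0 gauge_det1.
Qed.

Lemma chartK q : stratum W r q -> chart_dom q -> param (chart q) = q.
Proof.
move=> qS [q0 /gauge_detP qU]; apply/esym/gauge_diff_eq0_act => //.
by apply: gauge_diff_chart => //; exact: chart_dom0_unit.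
Qed.

Lemma paramK x : param_dom x -> chart (param x) = x.
Proof.
move=> [/gauge_detP xU x0]; apply: chart_unique; first exact: chart_dom0_unit.
exact: gauge_diff_act.
Qed.

Lemma param_image : param @` param_dom = stratum W r `&` chart_dom.
Proof.
apply/seteqP; split=> [_ [x xV <-]|q [qS qU]].
  have [xU x0] := xV; split.
    by apply: gauge_act_stratum => //; [exact: par_fixing|exact/gauge_detP].
  by split => //=; rewrite paramK.
exists (chart q); last exact: chartK.
by split; [exact: qU.2|rewrite /= chartK//; exact: qU.1].
Qed.

End Chart.

Section PairRational.
Variables (R : realType) (n1 n2 : nat).
Local Notation V := ('rV[R]_n1 * 'rV[R]_n2)%type.
Implicit Types U : set V.

Lemma rational_lin (E : normedModType R) (U : set E) (f : E -> R) :
  linear f -> continuous f -> rational_on U f.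
Proof.
move=> lf cf; pose fL : {linear E -> R} := HB.pack f (GRing.isLinear.Build _ _ _ _ f lf).
have df x : differentiable f x by apply: (@linear_differentiable _ _ _ fL).
apply: Rat_affine => // v; exists (f v) => x.
by rewrite deriveE// (@diff_lin _ _ _ fL).
Qed.

Lemma mx_rational_fst U : mx_rational U (fun z => z.1).
Proof.
move=> i j; apply: rational_lin => [a u v|z]; first by rewrite !mxE.
apply: (continuous_comp (f := fst) (g := fun M : 'rV[R]_n1 => M i j)).
  exact: cvg_fst.
exact: coord_continuous.
Qed.

Lemma mx_rational_snd U : mx_rational U (fun z => z.2).
Proof.
move=> i j; apply: rational_lin => [a u v|z]; first by rewrite !mxE.
apply: (continuous_comp (f := snd) (g := fun M : 'rV[R]_n2 => M i j)).
  exact: cvg_snd.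
exact: coord_continuous.
Qed.

End PairRational.

(** * Tangent vectors of the stratum *)

Section TangentSpace.
Variables (R : realType) (L : nat) (d : nat -> nat).
Local Notation weights := 'rV[R]_(\sum_(j < L) d j.+1 * d j)%N.
Local Notation gauge := 'rV[R]_(\sum_(j < L.+1) d j * d j)%N.
Local Notation gl := (@unpack R L.+1 d d).
Variables (W : 'M[R]_(d L, d 0%N)) (r : nat -> nat -> nat) (p : weights).
Hypothesis pS : stratum W r p.
Local Notation T := (tangentv W p p).

Lemma tangent_frame : exists2 K : 'M[R]_(\dim T, \sum_(j < L.+1) d j * d j),
  forall s, row s K \in fixing W & forall s, gauge_diff p p (row s K) = (vbasis T)`_s.
Proof.
have /choice[c cP] (s : 'I_(\dim T)) :
    exists c, c \in fixing W /\ gauge_diff p p c = (vbasis T)`_s.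
  have /tangentvP[c cW cE] : (vbasis T)`_s \in T.
    by rewrite vbasis_mem// mem_nth// size_tuple.
  by exists c.
by exists (\matrix_s c s) => s; rewrite rowK; have [] := cP s.
Qed.

Lemma stratum_chart : exists (U : set weights) (V : set 'rV[R]_(\dim T))
    (ch : weights -> 'rV[R]_(\dim T)) (pa : 'rV[R]_(\dim T) -> weights),
  [/\ open U, U p & smooth_on U ch] /\
  [/\ open V, smooth_on V pa, pa @` V = stratum W r `&` U &
      forall x, V x -> ch (pa x) = x].
Proof.
have [K KW KB] := tangent_frame.
exists (chart_dom K), (param_dom K), (chart K), (param K); split; split.
- exact: open_chart_dom.
- exact: chart_dom_p.
- apply: rational_smooth; first exact: open_chart_dom.
  have : mx_rational (chart_dom K) (chart K).
    exact: (mx_rational_sub (@subIsetl _ _ _) (rational_chart _)).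
  exact.
- exact: open_param_dom.
- apply: rational_smooth; first exact: open_param_dom.
  have : mx_rational (param_dom K) (param K).
    exact: (mx_rational_sub (@subIsetl _ _ _) (rational_param _)).
  exact.
- exact: param_image.
- exact: paramK.
Qed.

Lemma mx_rational_dotmul (V : normedModType R) (U : set V) n (f : V -> 'rV[R]_n) w :
  mx_rational U f -> rational_on U (fun x => dotmul (f x) w).
Proof.
move=> rf; apply: rational_sum => i; apply: Rat_mul; first exact: rf.
exact: rational_cst.
Qed.

Lemma gauge_diff_gauge1 q : gauge_diff p q (gauge1 R L d) = q - p.
Proof.
apply: layer_inj => j jL; rewrite of_layersK// layerB !gauge1E//; last exact: ltnW.
by rewrite mul1mx mulmx1.
Qed.

(** The term [gauge_diff 0 (q - p) c] is the layerwise product of [q - p] and [c]: this separates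
    the first-order part from the second-order one. *)
Lemma gauge_diff_shift q c : gauge_diff p q c = gauge_diff p p c + gauge_diff (0 : weights) (q - p) c.
Proof.
apply: layer_inj => j jL; rewrite layerD !of_layersK// layerB layer0.
by rewrite mulmx0 subr0 mulmxBl [RHS]addrC addrA subrK.
Qed.

Lemma gauge_diff0Z x q c : gauge_diff (0 : weights) (x *: q) c = x *: gauge_diff (0 : weights) q c.
Proof.
apply: layer_inj => j jL; rewrite layerZ !of_layersK// layerZ layer0.
by rewrite mulmx0 !subr0 scalemxAl.
Qed.

(* Near p a curve in the stratum is q = (1 + c).p with c -> 0, so that
   q - p = - D c - (q - p) c, whose second term is of second order. *)
Lemma tangent_space_orthogonal v w : tangent_space_at (stratum W r) p v ->
  (forall u, u \in T -> dotmul u w = 0) -> dotmul v w = 0.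
Proof.
move=> [e [g [e0 gS gW g0 gv]]] Tw.
have [K KW KB] := tangent_frame.
have ball0 : ball (0 : R) e 0 by exact: ballxx.
have [dg _] := gS 1%N; have {}dg := dg 0 ball0.
have cg : g x @[x --> (0 : R)] --> p.
  by rewrite -g0; exact: differentiable_continuous.
have fv : (h^-1 *: (g h - p) @[h --> (0 : R)^']) --> v.
  have : derivable g 0 1 by exact: diff_derivable.
  rewrite /derivable => /cvg_ex[l fl].
  have lE : l = v.
    rewrite -gv derive1E; apply/esym/cvg_lim => //.
  rewrite -lE; apply: cvg_trans fl; apply: near_eq_cvg.
  by apply: nearW => h; rewrite /= addr0 g0 [h *: 1]mulr1.
have xc : (chart K (g h) @[h --> (0 : R)^']) --> (0 : 'rV[R]_(\dim T)).
  have -> : (0 : 'rV[R]_(\dim T)) = chart K p by rewrite chart_p.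
  apply: cvg_within_filter.
  have := mx_rational_continuous (open_chart_dom0 (K:=K)) (rational_chart K)
    (chart_dom_p KB).1.
  by move=> cc; apply: continuous_cvg cc cg.
have cK : (chart K (g h) *m K @[h --> (0 : R)^']) --> (0 : gauge).
  have rK : mx_rational setT (fun x : 'rV[R]_(\dim T) => x *m K).
    by apply: mx_rationalM; [exact: mx_rational_id|exact: mx_rational_cst].
  rewrite -[X in _ --> X](mul0mx _ K).
  have c0 : {for 0, continuous (fun x : 'rV[R]_(\dim T) => x *m K)}.
    exact: mx_rational_continuous openT rK I.
  exact: (continuous_cvg _ c0 xc).
(* The equation paired with [w] and divided by [h]: the term in T drops out, so [G] vanishes along
   the difference quotients, while its limit is [dotmul v w]. *)
pose G (z : weights * gauge) := dotmul z.1 w + dotmul (gauge_diff (0 : weights) z.1 z.2) w.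
have cG : {for (v, 0), continuous G}.
  apply: differentiable_continuous; apply: (rational_differentiable openT) => //.
  apply: Rat_add; apply: mx_rational_dotmul; first exact: mx_rational_fst.
  by apply: mx_rational_gauge_diff; [exact: mx_rational_fst|exact: mx_rational_snd].
have fc : ((h^-1 *: (g h - p), chart K (g h) *m K) @[h --> (0 : R)^'])
    --> (v, 0 : gauge).
  exact: cvg_pair fv cK.
have Gv : (G (h^-1 *: (g h - p), chart K (g h) *m K) @[h --> (0 : R)^'])
    --> G (v, 0).
  exact: continuous_cvg cG fc.
have G0 : \forall h \near (0 : R)^',
    G (h^-1 *: (g h - p), chart K (g h) *m K) = 0.
  have nU : \forall h \near (0 : R), chart_dom0 K (g h).
    apply: cg; apply: open_nbhs_nbhs; split; first exact: open_chart_dom0.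
    exact: (chart_dom_p KB).1.
  have nB : \forall h \near (0 : R), ball (0 : R) e h.
    exact: nbhsx_ballx.
  apply: cvg_within; near=> h.
  have qS : stratum W r (g h) by apply: gW; near: h.
  have qU : jac K (g h) \in unitmx by apply: chart_dom0_unit; near: h.
  have := gauge_diff_chart pS KW qS qU; set c := chart K (g h) *m K.
  rewrite /par linearD /= gauge_diff_gauge1 gauge_diff_shift -/c.
  move=> /(congr1 (fun u : weights => dotmul u w)).
  rewrite dotmulDl (dotmulDl (gauge_diff p p c)) (Tw (gauge_diff p p c)) ?add0r => [E|]; last first.
    by apply/tangentvP; exists c => //; exact: mulK_fixing.
  by rewrite /G /= gauge_diff0Z !dotmulZl -mulrDr E dotmulC dotmul0r mulr0.
have G0c : (G (h^-1 *: (g h - p), chart K (g h) *m K) @[h --> (0 : R)^']) --> (0 : R).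
  exact: cvg_near_cst.
have : G (v, 0) = 0 by apply: (norm_cvg_unique Gv G0c).
have a0 : gauge_diff (0 : weights) v 0 = 0 by exact: linear0.
by rewrite /G /= a0 (dotmulC 0) dotmul0r addr0.
Unshelve. all: by end_near. Qed.

(** The curve is (1 + t c).p with [c = - c0], the sign making up for that of [gauge_diff]. Its
    difference quotient equals [- gauge_diff p (g h) c] exactly, so the derivative follows from
    continuity. *)
Lemma tangent_space_velocity v : v \in T -> tangent_space_at (stratum W r) p v.
Proof.
move=> /tangentvP[c0 c0W ->]; pose c := - c0.
have cW : c \in fixing W by rewrite memvN.
pose y (t : R) : gauge := gauge1 R L d + t *: c.
have ry : mx_rational (setT : set R) y.
  apply: mx_rationalD; first exact: mx_rational_cst.
  move=> i j; apply: (Rat_ext (Rat_mul (rational_id _) (rational_cst _ (c i j)))).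
  by move=> t _; rewrite [RHS]mxE.
pose D : set R := [set t | gauge_det (y t) != 0].
have oD : open D.
  by rewrite -[D]setTI; apply: open_rational; [exact: openT|exact: rational_gauge_det].
have D0 : D 0 by rewrite /D /= /y scale0r addr0 gauge_det1.
have : nbhs (0 : R) D by exact: open_nbhs_nbhs.
move=> /nbhs_ballP[e /= e0 eD].
pose g (t : R) : weights := gauge_act (y t) p.
have rg : mx_rational D g.
  by apply: mx_rational_gauge_act => //; exact: mx_rational_sub ry.
have g0 : g 0 = p by rewrite /g /y scale0r addr0 gauge_act1.
exists e, g; split => //.
- apply: rational_smooth; first exact: ball_open.
  have : mx_rational (ball (0 : R) e) g by exact: mx_rational_sub eD rg.
  exact.
- move=> t /eD/gauge_detP tU; apply: gauge_act_stratum => //.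
  by rewrite memvD ?gauge1_fixing ?memvZ.
have cg : {for 0, continuous g} by exact: mx_rational_continuous oD rg D0.
have ca : {for p, continuous (fun q => - gauge_diff p q c)}.
  apply: (mx_rational_continuous openT) => //.
  apply: mx_rationalN; apply: mx_rational_gauge_diff; first exact: mx_rational_id.
  exact: mx_rational_cst.
rewrite /derive1; apply/cvg_lim => //.
have -> : gauge_diff p p c0 = - gauge_diff p p c by rewrite /c linearN opprK.
have lim0 : (- gauge_diff p (g h) c @[h --> (0 : R)^']) --> - gauge_diff p p c.
  have cg2 : g h @[h --> (0 : R)] --> p by rewrite -[X in _ --> X]g0; exact: cg.
  by apply: cvg_within_filter; apply: continuous_cvg ca cg2.
apply: cvg_trans lim0; apply: near_eq_cvg.
have nD : \forall h \near (0 : R)^', D h.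
  by apply: cvg_within; exact: open_nbhs_nbhs.
near=> h.
have h0 : h != 0 by near: h; exact: nbhs_dnbhs_neq.
have /gauge_detP hU : D h by near: h.
have := gauge_diff_act p hU; rewrite /y linearD linearZ /= gauge_diff_gauge1 -/(y h) -/(g h).
move=> /eqP; rewrite addr_eq0 => /eqP E.
by rewrite addr0 g0 E scalerN scalerA mulVf// scale1r.
Unshelve. all: by end_near. Qed.

End TangentSpace.

Theorem theorem52 (R : realType) (L : nat) (d : nat -> nat)
  (L_ge1 : (1 <= L)%N) (d_ge1 : forall j, (j <= L)%N -> (1 <= d j)%N)
  (W : 'M[R]_(d L, d 0%N)) (r : nat -> nat -> nat)
  (theta : 'rV[R]_(\sum_(j < L) d j.+1 * d j)%N)
  (theta_in : stratum W r theta)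
  (a b : forall k j i : nat, {vspace 'cV[R]_(d j)})
  (flow_ab : flow_prebasis theta a b) :
  [/\ exists2 m : nat, m%:Z = Dstrat theta & embedded_manifold m (stratum W r),
      prebasis (Theta_strat theta a b) (tangent_space_at (stratum W r) theta)
    & prebasis (Psi_strat theta a b) (normal_space_at (stratum W r) theta)].
Proof.
have [thetaW _] := theta_in.
have [TE normT tangT] := tangent_normal L_ge1 flow_ab; rewrite thetaW in TE normT tangT.
have tanE : tangent_space_at (stratum W r) theta = [set` theta_span theta a b].
  apply/seteqP; split=> v /=; last first.
    by rewrite -TE; exact: tangent_space_velocity.
  (* Membership in T is tested against the normal side, as velocities of curves are controlled
     through their products with vectors orthogonal to T. *)
  rewrite -TE => vT; apply: tangT => w wPsi.
  apply: (tangent_space_orthogonal theta_in vT) => u uT.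
  by apply: (tangent_psi_orthogonal L_ge1 flow_ab) => //; rewrite thetaW.
split.
- exists (\dim (theta_span theta a b)); first exact: dim_theta_span_Dstrat.
  (* The chart at [p] has the dimension of the space T built at [p], which is constant along the
     stratum. *)
  move=> p pS; rewrite -TE.
  rewrite -(dim_tangentv_stratum pS pS theta_in theta_in).
  exact: stratum_chart.
- exact: prebasis_Theta.
- apply: prebasis_Psi => //; apply/seteqP; split=> v /=.
    by rewrite /normal_space_at /= tanE => vN; apply: normT => u; rewrite TE; exact: vN.
  move=> vPsi u; rewrite tanE /= -TE => uT.
  by apply: (tangent_psi_orthogonal L_ge1 flow_ab) => //; rewrite thetaW.
Qed.
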